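(* Let $\alpha\ge0$ and $\varepsilon\in(0,1)$. Assume $(\mathrm{A}_1)$–$(\mathrm{A}_3)$ as spelled out in the context, let $(\gamma_k)_{k\ge1}$ be a non-increasing sequence of positive regularization parameters with associated regularizations $\mathcal{R}_{\gamma_k}$ of $\mathcal{R}$, with exponent $\sigma>0$, and let $M=\eta+\varepsilon^\alpha\delta_1$ with $\eta>0$. Suppose further that there are $\omega\in(0,1)$ and $C>0$ such that $$\frac{\gamma_{k-1}^\sigma}{\gamma_k}\le C\omega^k\quad\text{for all }k\ge2,$$ and that $$\overline\omega:=\omega+\sqrt{\frac{M}{\underline\gamma C_p^{-1}+M}}<1.$$ Then the iterative sequence $\{u_\varepsilon^k\}_{k\ge1}$ defined in the context is Cauchy in $H^1(\Omega^\varepsilon)$. Consequently, the microscopic problem $(P_\varepsilon)$ admits a unique weak solution $u_\varepsilon$ in $H^1(\Omega^\varepsilon)$.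
   Context: Geometry. Let $d\in\{2,3\}$, $\Omega\subset\mathbb{R}^d$ a bounded polygonal (polyhedral) domain, $Y=[0,1]^d$ the periodicity cell. $Y_l\subset Y$ is the pore part of the cell, i.e. $Y$ minus a hole with Lipschitz boundary $\Gamma$. For $\varepsilon\in(0,1)$, $\Omega^\varepsilon\subset\Omega$ is the perforated domain obtained from $\Omega$ by removing $\varepsilon$-scaled, $\varepsilon$-periodically repeated copies of the hole; it is bounded, connected, and has Lipschitz boundary $\partial\Omega^\varepsilon=\Gamma^\varepsilon\cup\Gamma^{\mathrm{ext}}$, where $\Gamma^\varepsilon$ is the union of the boundaries of the removed holes and $\Gamma^{\mathrm{ext}}=\partial\Omega$ is the exterior boundary. Function space. $V^\varepsilon=\{u\in H^1(\Omega^\varepsilon):u=0\text{ on }\Gamma^{\mathrm{ext}}\}$. $C_p>0$ is a constant independent of $\varepsilon$ with $\|u\|^2_{L^2(\Omega^\varepsilon)}\le C_p\|\nabla u\|^2_{L^2(\Omega^\varepsilon)}$ for all $u\in V^\varepsilon$ (such a constant exists). Degenerate function. A function $F:\mathbb{R}\to\mathbb{R}$ is degenerate at $x_0\in\mathbb{R}$ if there is $\delta_1>0$ with $0\le F'(x)\le\delta_1$ for a.e. $x\in\mathbb{R}$ and: (i) if $\lim_{x\to s^+}F'(x)\lim_{x\to s^-}F'(x)=0$ for some $s\in\mathbb{R}$, then $s=x_0$; (ii) there exist $\delta_0,r_{x_0}>0$ with $0<\delta_0\le F'(x)\le\delta_1$ for a.e. $x\in\mathbb{R}\setminus\mathcal{B}(x_0,r_{x_0})$,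 where $\mathcal{B}(x_0,r_{x_0})$ is the ball of center $x_0$ and radius $r_{x_0}$; (iii) $F'$ is non-decreasing on $\overline{\mathcal{B}(x_0,r_{x_0})}$. Regularization. For such $F$ (with constants $\delta_0,\delta_1$) and $\gamma>0$, a regularization $F_\gamma:\mathbb{R}\to\mathbb{R}$ of $F$ satisfies $0<\gamma\delta_0\le F_\gamma'(x)\le\delta_1$ and $|F(x)-F_\gamma(x)|\le C\gamma^\sigma$ for all $x\in\mathbb{R}$, where $\sigma>0$ and $C>0$ do not depend on $\gamma$ or $x$. Existence of such regularizations of $\mathcal{R}$ is assumed. Assumptions. $(\mathrm{A}_1)$ $\mathbf{A}=(a_{ij}):Y\to\mathbb{R}^{d\times d}$ is essentially bounded, $Y$-periodic, symmetric, globally Lipschitz, and there are $\varepsilon$-independent $\underline\gamma,\overline\gamma>0$ with $\underline\gamma|\xi|^2\le\sum_{i,j}a_{ij}(x/\varepsilon)\xi_i\xi_j\le\overline\gamma|\xi|^2$ for all $\xi\in\mathbb{R}^d$. $(\mathrm{A}_2)$ $\mathcal{R}:\mathbb{R}\to\mathbb{R}$ is degenerate at some point, with constants $\delta_0,\delta_1$. $(\mathrm{A}_3)$ $f\in L^2(\Omega)$. Microscopic problem $(P_\varepsilon)$: $\nabla\cdot(-\mathbf{A}(x/\varepsilon)\nabla u_\varepsilon)+\varepsilon^\alpha\mathcal{R}(u_\varepsilon)=f$ in $\Omega^\varepsilon$, $-\mathbf{A}(x/\varepsilon)\nabla u_\varepsilon\cdot n=0$ on $\Gamma^\varepsilon$,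 $u_\varepsilon=0$ on $\Gamma^{\mathrm{ext}}$. A weak solution is $u_\varepsilon\in H^1(\Omega^\varepsilon)$ with $u_\varepsilon=0$ on $\Gamma^{\mathrm{ext}}$ such that $\int_{\Omega^\varepsilon}\mathbf{A}(x/\varepsilon)\nabla u_\varepsilon\cdot\nabla\varphi\,dx+\varepsilon^\alpha\int_{\Omega^\varepsilon}\mathcal{R}(u_\varepsilon)\varphi\,dx=\int_{\Omega^\varepsilon}f\varphi\,dx$ for all $\varphi\in V^\varepsilon$. Iteration. $u_\varepsilon^0=0$, and for $k\ge1$, $u_\varepsilon^k\in V^\varepsilon$ is the unique solution of $$\int_{\Omega^\varepsilon}\mathbf{A}(x/\varepsilon)\nabla u_\varepsilon^k\cdot\nabla\varphi\,dx+M\int_{\Omega^\varepsilon}u_\varepsilon^k\varphi\,dx=\int_{\Omega^\varepsilon}f\varphi\,dx+M\int_{\Omega^\varepsilon}u_\varepsilon^{k-1}\varphi\,dx-\varepsilon^\alpha\int_{\Omega^\varepsilon}\mathcal{R}_{\gamma_k}(u_\varepsilon^{k-1})\varphi\,dx\quad\text{for all }\varphi\in V^\varepsilon.$$ *)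

(* Defs.v *)
From HB Require Import structures.
From mathcomp Require Import all_boot all_order all_algebra.
From mathcomp Require Import all_classical all_reals all_analysis.

Set Implicit Arguments.
Unset Strict Implicit.
Unset Printing Implicit Defensive.
Import Order.TTheory GRing.Theory Num.Theory.
Import numFieldNormedType.Exports.

Local Open Scope classical_set_scope.
Local Open Scope ring_scope.

(* 'rV[R]_n carries the sigma-algebra generated by the coordinate maps, which is
   its Borel sigma-algebra. *)
Definition rV_display : measure_display. Proof. exact: default_measure_display. Qed.

Section measurable_rV.
Variables (R : realType) (n : nat).

Let coors : 'I_n -> 'rV[R]_n -> measurableTypeR R := fun i x => x 0 i.

Let rV_set0 : g_sigma_preimage coors set0.
Proof. exact: sigma_algebra0. Qed.

Let rV_setC A : g_sigma_preimage coors A -> g_sigma_preimage coors (~` A).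
Proof. exact: sigma_algebraC. Qed.

Let rV_bigcup (F : (set 'rV[R]_n)^nat) :
  (forall i, g_sigma_preimage coors (F i)) ->
  g_sigma_preimage coors (\bigcup_i (F i)).
Proof. exact: sigma_algebra_bigcup. Qed.

HB.instance Definition _ := @isMeasurable.Build rV_display
  'rV[R]_n (g_sigma_preimage coors) rV_set0 rV_setC rV_bigcup.

Lemma measurable_coord (i : 'I_n) :
  measurable_fun setT (fun x : 'rV[R]_n => x 0 i : measurableTypeR R).
Proof.
move=> _ Y mY; rewrite setTI; apply: sub_sigma_algebra => /=.
rewrite -bigcup_seq/=; exists i => /=; first by rewrite mem_index_enum.
by exists Y => //; rewrite setTI.
Qed.

Lemma measurable_fun_coord d (T : measurableType d) (f : T -> 'rV[R]_n) :
  (forall i, measurable_fun setT (fun x => f x 0 i : measurableTypeR R)) ->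
  measurable_fun setT f.
Proof.
move=> mf _ Y mY; rewrite setTI.
suff : g_sigma_preimage coors `<=` [set Y | measurable (f @^-1` Y)] by exact.
apply: smallest_sub.
  split => /=.
  - by rewrite preimage_set0.
  - by move=> A mA; rewrite setTD preimage_setC; exact: measurableC.
  - by move=> F mF; rewrite preimage_bigcup; exact: bigcupT_measurable.
rewrite -bigcup_seq => A [i _ [B mB <-]] /=.
by rewrite setTI -comp_preimage -[X in measurable X]setTI; exact: mf.
Qed.

End measurable_rV.

Section lebesgue_rV.
Variable R : realType.
Local Notation borelR := (measurableTypeR R).

(* Lebesgue measure on 'rV[R]_n is the n-fold product of the one on R; its values
   on boxes are given by lebesgue_rV_box. *)
Definition cons_rV n (p : borelR * 'rV[R]_n) : 'rV[R]_n.+1 :=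
  \row_i if unlift ord0 i is Some j then p.2 0 j else p.1.

Lemma measurable_cons_rV n : measurable_fun setT (@cons_rV n).
Proof.
apply: measurable_fun_coord => i.
under eq_fun do rewrite mxE.
case: (unlift ord0 i) => [j|]; last exact: measurable_fst.
exact: (measurableT_comp (measurable_coord j) measurable_snd).
Qed.

Definition uncons_rV n (v : 'rV[R]_n.+1) : borelR * 'rV[R]_n :=
  (v 0 ord0, \row_j v 0 (lift ord0 j)).

Lemma measurable_uncons_rV n : measurable_fun setT (@uncons_rV n).
Proof.
apply: measurable_fun_pair; first exact: measurable_coord.
apply: measurable_fun_coord => i.
under eq_fun do rewrite mxE.
exact: measurable_coord.
Qed.

Lemma cons_rVK n : cancel (@cons_rV n) (@uncons_rV n).
Proof.
move=> [x v]; rewrite /uncons_rV /cons_rV mxE unlift_none; congr pair.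
by apply/rowP => j; rewrite !mxE liftK.
Qed.

Lemma uncons_rVK n : cancel (@uncons_rV n) (@cons_rV n).
Proof.
move=> v; apply/rowP => i; rewrite mxE /uncons_rV/=.
by case: unliftP => [j ->|->//]; rewrite mxE.
Qed.

Section step.
Variables (n : nat) (mu : {sigma_finite_measure set 'rV[R]_n -> \bar R}).

Definition lebesgue_step : set 'rV[R]_n.+1 -> \bar R :=
  pushforward (lebesgue_measure \x mu)%E (@cons_rV n).

Let mcons := @measurable_cons_rV n.

Let step0 : lebesgue_step set0 = 0%E.
Proof. by rewrite /lebesgue_step /pushforward preimage_set0 measure0. Qed.

Let step_ge0 A : (0 <= lebesgue_step A)%E.
Proof. exact: measure_ge0. Qed.

Let step_sigma_additive : semi_sigma_additive lebesgue_step.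
Proof. exact: measure_semi_sigma_additive. Qed.

HB.instance Definition _ := isMeasure.Build _ _ _ lebesgue_step
  step0 step_ge0 step_sigma_additive.

Let sigma_finite_step : sigma_finite setT lebesgue_step.
Proof.
have /sigma_finiteP[F [TF ndF Foo]] := sigma_finiteT (@lebesgue_measure R).
have /sigma_finiteP[G [TG ndG Goo]] := sigma_finiteT mu.
exists (fun k => @uncons_rV n @^-1` (F k `*` G k)).
  apply/seteqP; split => [v _|//].
  have [i _ Fi] : (\bigcup_i F i) (uncons_rV v).1 by rewrite -TF.
  have [j _ Gj] : (\bigcup_i G i) (uncons_rV v).2 by rewrite -TG.
  exists (maxn i j) => //; split.
  - by move: Fi; exact/subsetPset/ndF/leq_maxl.
  - by move: Gj; exact/subsetPset/ndG/leq_maxr.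
move=> k; have [mF Fk] := Foo k; have [mG Gk] := Goo k; split.
  rewrite -[X in measurable X]setTI; apply: measurable_uncons_rV => //.
  exact: measurableX.
rewrite /lebesgue_step /pushforward -comp_preimage.
rewrite (_ : _ \o _ = id); last by rewrite funeqE => p /=; rewrite cons_rVK.
by rewrite preimage_id product_measure1E// lte_mul_pinfty// ge0_fin_numE.
Qed.

HB.instance Definition _ := @Measure_isSigmaFinite.Build _ _ _
  lebesgue_step sigma_finite_step.

End step.

Fixpoint lebesgue_rV n : {sigma_finite_measure set 'rV[R]_n -> \bar R} :=
  match n with
  | 0 => [the {sigma_finite_measure set 'rV[R]_0 -> \bar R} of \d_(0 : 'rV[R]_0)]
  | n'.+1 => [the {sigma_finite_measure set 'rV[R]_n'.+1 -> \bar R} of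
               lebesgue_step (lebesgue_rV n')]
  end.

Lemma lebesgue_rV_box n (B : 'I_n -> set borelR) :
  (forall i, measurable (B i)) ->
  (lebesgue_rV n [set x : 'rV[R]_n | forall i, B i (x 0%R i)] =
   \prod_(i < n) lebesgue_measure (B i))%E.
Proof.
elim: n B => [|n ih] B mB.
  rewrite big_ord0 /= diracE mem_set//= => i; by case: i.
rewrite big_ord_recl -(ih (fun i => B (lift ord0 i)))//= /lebesgue_step.
rewrite -product_measure1E//; last first.
  rewrite (_ : [set _ | _] =
    \big[setI/setT]_(i < n) ((fun x : 'rV[R]_n => x 0 i) @^-1` B (lift ord0 i))).
    apply: bigsetI_measurable => i _; rewrite -[X in measurable X]setTI.
    exact: measurable_coord.
  apply/seteqP; split => [x Bx|x].
    by rewrite -bigcap_seq => i _ /=; exact: Bx.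
  by rewrite -bigcap_seq => Bx i; apply: Bx => /=; rewrite mem_index_enum.
rewrite /pushforward; congr product_measure1.
apply/seteqP; split => [[x v] /= Bv|[x v] /= [Bx Bv] i].
  split; first by have := Bv ord0; rewrite mxE unlift_none.
  by move=> i; have := Bv (lift ord0 i); rewrite mxE liftK.
by rewrite mxE; case: unliftP => [j ->|->].
Qed.

End lebesgue_rV.

Section geometry.
Variables (R : realType) (d : nat).
Implicit Types (D P T Om : set 'rV[R]_d) (K : set 'rV[int]_d).

Definition dot (x y : 'rV[R]_d) : R := \sum_i x 0 i * y 0 i.

Definition boundary D : set 'rV[R]_d := closure D `\` interior D.

(* Near each boundary point D is the region below the graph, in some unit
   direction e, of a Lipschitz function of the component orthogonal to e. Points
   on the graph itself are unconstrained, so D may be open or closed. *)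
Definition lipschitz_boundary D : Prop :=
  forall p, boundary D p ->
  exists (r : R) (e : 'rV[R]_d) (phi : 'rV[R]_d -> R),
    [/\ 0 < r, dot e e = 1, lipschitz phi &
     forall x, ball p r x ->
       let h := dot (x - p) e in
       let y := x - p - h *: e in
       (h < phi y -> D x) /\ (D x -> h <= phi y)].

(* A polyhedron is given by the list of its defining half-spaces
   [x | dot h.1 x <= h.2]. *)
Definition polyhedral D : Prop :=
  exists F : seq (seq ('rV[R]_d * R)),
    D = interior [set x | has (all (fun h => dot h.1 x <= h.2)) F].

Definition polyhedral_domain D : Prop :=
  [/\ D !=set0, open D, connected D, bounded_set D & polyhedral D].

Definition unit_cell : set 'rV[R]_d := [set y | forall i, 0 <= y 0 i <= 1].

Definition cell_hole T : Prop :=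
  [/\ T !=set0, closed T, T `<=` unit_cell & lipschitz_boundary T].

Definition lattice (k : 'rV[int]_d) : 'rV[R]_d := map_mx intr k.

Definition scaled_copy (eps : R) T (k : 'rV[int]_d) : set 'rV[R]_d :=
  [set eps *: (lattice k + y) | y in T].

(* K is the set of lattice points whose hole copy is removed: every cell lying
   in Om is perforated, no removed hole leaves Om, and near the boundary of Om
   both the choice of K by cells and its choice by holes are allowed. *)
Definition removed_cells (eps : R) T Om K : Prop :=
  (forall k, scaled_copy eps unit_cell k `<=` Om -> K k) /\
  (forall k, K k -> scaled_copy eps T k `<=` Om).

Definition perforated (eps : R) T Om K : set 'rV[R]_d :=
  Om `\` \bigcup_(k in K) scaled_copy eps T k.

Definition hole_boundary (eps : R) T K : set 'rV[R]_d :=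
  \bigcup_(k in K) boundary (scaled_copy eps T k).

Definition perforated_geometry (eps : R) T Om K : Prop :=
  let Om_eps := perforated eps T Om K in
  [/\ removed_cells eps T Om K,
      bounded_set Om_eps,
      connected Om_eps,
      lipschitz_boundary Om_eps &
      boundary Om_eps = hole_boundary eps T K `|` boundary Om].

End geometry.

Section sobolev.
Variables (R : realType) (d : nat).
Local Notation mu := (lebesgue_rV R d).
Implicit Types (D G : set 'rV[R]_d).
Implicit Types (u f phi psi : 'rV[R]_d -> R) (g h : 'rV[R]_d -> 'rV[R]_d).

Definition L2 D u : Prop :=
  measurable_fun D u /\ mu.-integrable D (fun x => (u x ^+ 2)%:E).

Definition partial (i : 'I_d) u : 'rV[R]_d -> R :=
  fun x => 'D_(delta_mx 0 i) u x.

Definition gradient u : 'rV[R]_d -> 'rV[R]_d := fun x => \row_i partial i u x.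

(* All iterated partial derivatives exist and are continuous. *)
Definition smooth u : Prop :=
  forall l : seq 'I_d,
    (forall i x, derivable (foldr partial u l) x (delta_mx 0 i)) /\
    continuous (foldr partial u l).

Definition fsupport u : set 'rV[R]_d := closure [set x | u x != 0].

Definition test_function D phi : Prop :=
  [/\ smooth phi, compact (fsupport phi) & fsupport phi `<=` D].

Definition weak_gradient D u g : Prop :=
  forall phi, test_function D phi -> forall i,
    \int[mu]_(x in D) (u x * partial i phi x) =
    - \int[mu]_(x in D) (g x 0 i * phi x).

(* An element of H^1(D) is represented by a function together with (a
   representative of) its weak gradient, which is determined up to a null set. *)
Definition H1 D u g : Prop :=
  [/\ L2 D u, forall i, L2 D (fun x => g x 0 i) & weak_gradient D u g].

Definition H1norm D u g : R :=
  Num.sqrt (\int[mu]_(x in D) (u x ^+ 2) + \int[mu]_(x in D) dot (g x) (g x)).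

(* The functions of H^1(D) with zero trace on the part G of the boundary of the
   bounded open set D: the H^1(D)-closure of the smooth functions vanishing in a
   neighbourhood of G. *)
Definition H1_zero D G u g : Prop :=
  H1 D u g /\
  forall e : R, 0 < e -> exists psi,
    [/\ smooth psi, fsupport psi `&` G = set0 &
        H1norm D (u \- psi) (g \- gradient psi) < e].

Definition H1_cauchy D (u : nat -> 'rV[R]_d -> R)
    (g : nat -> 'rV[R]_d -> 'rV[R]_d) : Prop :=
  forall e : R, 0 < e -> exists N : nat, forall m n : nat,
    (N <= m)%N -> (N <= n)%N -> H1norm D (u m \- u n) (g m \- g n) < e.

Definition poincare D G (Cp : R) : Prop :=
  forall u g, H1_zero D G u g ->
    \int[mu]_(x in D) (u x ^+ 2) <= Cp * \int[mu]_(x in D) dot (g x) (g x).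

End sobolev.

Section data.
Variable R : realType.
Implicit Types F Fg : R -> R.

(* The derivative of F is only required to exist almost everywhere; one-sided
   limits and monotonicity of F' are understood along the points at which F is
   derivable. *)
Definition degenerate F (x0 delta0 delta1 : R) : Prop :=
  let Der := [set x : R | derivable F x 1] in
  [/\ 0 < delta1,
      {ae lebesgue_measure, forall x : R, Der x /\ 0 <= derive1 F x <= delta1},
      forall s lr ll : R,
        derive1 F @ within Der s^'+ --> lr -> derive1 F @ within Der s^'- --> ll ->
        lr * ll = 0 -> s = x0 &
      exists r : R,
        [/\ 0 < r, 0 < delta0,
            {ae lebesgue_measure, forall x : R,
               ~ ball x0 r x -> delta0 <= derive1 F x <= delta1} &
            forall x y : R, Der x -> Der y ->
              x0 - r <= x -> x <= y -> y <= x0 + r -> derive1 F x <= derive1 F y]].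

Definition regularization F (delta0 delta1 C sigma gam : R) Fg : Prop :=
  forall x : R,
    [/\ derivable Fg x 1,
        0 < gam * delta0,
        gam * delta0 <= derive1 Fg x <= delta1 &
        `|F x - Fg x| <= C * gam `^ sigma].

Variable d : nat.

Definition coefficient (A : 'rV[R]_d -> 'M[R]_d) (glow gup : R) : Prop :=
  [/\ exists C : R, forall i j, {ae lebesgue_rV R d, forall y, `|A y i j| <= C},
      forall y (k : 'rV[int]_d), A (y + lattice R k) = A y,
      forall y, (A y)^T = A y,
      forall i j, lipschitz (fun y => A y i j) &
      [/\ 0 < glow, 0 < gup &
        forall y xi : 'rV[R]_d,
          glow * dot xi xi <= \sum_i \sum_j A y i j * xi 0 i * xi 0 j
            <= gup * dot xi xi]].

End data.

Section problem.
Variables (R : realType) (d : nat).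
Variables (D G : set 'rV[R]_d) (A : 'rV[R]_d -> 'M[R]_d) (eps alpha : R).
Local Notation mu := (lebesgue_rV R d).

Definition diffusion (g h : 'rV[R]_d -> 'rV[R]_d) : R :=
  \int[mu]_(x in D)
    (\sum_i \sum_j A (eps^-1 *: x) i j * g x 0 j * h x 0 i).

Definition weak_solution (Rf : R -> R) (f u : 'rV[R]_d -> R)
    (g : 'rV[R]_d -> 'rV[R]_d) : Prop :=
  H1_zero D G u g /\
  forall phi h, H1_zero D G phi h ->
    diffusion g h + eps `^ alpha * \int[mu]_(x in D) (Rf (u x) * phi x) =
    \int[mu]_(x in D) (f x * phi x).

(* Rg k is the regularization used in step k >= 1; the values g 0 and Rg 0 are
   irrelevant. *)
Definition iteration (Rg : nat -> R -> R) (M : R) (f : 'rV[R]_d -> R)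
    (u : nat -> 'rV[R]_d -> R) (g : nat -> 'rV[R]_d -> 'rV[R]_d) : Prop :=
  u 0%N = (fun=> 0) /\
  forall k : nat, (1 <= k)%N ->
    H1_zero D G (u k) (g k) /\
    forall phi h, H1_zero D G phi h ->
      diffusion (g k) h + M * \int[mu]_(x in D) (u k x * phi x) =
      \int[mu]_(x in D) (f x * phi x)
      + M * \int[mu]_(x in D) (u k.-1 x * phi x)
      - eps `^ alpha * \int[mu]_(x in D) (Rg k (u k.-1 x) * phi x).

End problem.

(* Main.v *)
Require Import Defs.
From HB Require Import structures.
From mathcomp Require Import all_boot all_order all_algebra.
From mathcomp Require Import all_classical all_reals all_analysis.
From mathcomp Require Import measurable_realfun ring lra.

Set Implicit Arguments.
Unset Strict Implicit.
Unset Printing Implicit Defensive.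
Import Order.TTheory GRing.Theory Num.Theory.
Import numFieldNormedType.Exports.

Local Open Scope classical_set_scope.
Local Open Scope ring_scope.

(* The difference of two consecutive iterates solves the linear problem whose
   source is the increment of [s |-> M s - eps^alpha R_k s], a function of slope
   in [[eta, M]], up to an error of order gamma_{k-1}^sigma = O(omega^k).
   Testing with the difference itself and using the Poincare inequality, its
   L^2 norm contracts by M / (glow / Cp + M), and the H^1 norm is controlled by
   the source.  For existence the same estimate is applied to the iteration
   with R itself, each step being solved by the Riesz representation theorem;
   R is monotone and delta1-Lipschitz because it is a uniform limit of the R_k:
   gamma_k^sigma <= C gamma_1 omega^k tends to 0. *)

(** * Semi-inner products *)

Section semi_inner_product.
Context {R : realType} {E : lmodType R}.
Implicit Types (V : set E) (b : E -> E -> R) (u v w : E).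

(** An element of H^1 is a function paired with a chosen weak gradient, not a class modulo null
    sets, so the forms below are only positive semidefinite and a limit is determined only up to
    seminorm zero. Hilbert space arguments are therefore carried out for a semi-inner product on a
    subspace of a space of functions, with completeness expressed by sequences; uniqueness of the
    solution reappears as equality almost everywhere. The bounds on the derivative of [Rf] in
    [degenerate] hold almost everywhere, and such bounds do not control increments, as the Cantor
    function shows. The regularizations are differentiable everywhere, so the mean value theorem
    applies to them, and the slope bounds pass to [Rf] in the limit. *)

Definition subspace V : Prop :=
  V 0 /\ forall (c : R) u v, V u -> V v -> V (c *: u + v).

Definition linear_on V (L : E -> R) : Prop :=
  forall (c : R) u v, V u -> V v -> L (c *: u + v) = c * L u + L v.

(** All conditions are restricted to [V] because the integral of a product is bilinear only where
    the products are integrable. *)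
Definition semi_inner V b : Prop :=
  [/\ forall w, V w -> linear_on V (b ^~ w),
      forall u v, V u -> V v -> b u v = b v u &
      forall u, V u -> 0 <= b u u].

Definition seminorm b u : R := Num.sqrt (b u u).

Definition semi_cauchy b (u : nat -> E) : Prop :=
  forall e : R, 0 < e -> exists N : nat, forall m n : nat,
    (N <= m)%N -> (N <= n)%N -> seminorm b (u m - u n) < e.

Definition semi_cvg b (u : nat -> E) (l : E) : Prop :=
  forall e : R, 0 < e -> exists N : nat, forall n : nat,
    (N <= n)%N -> seminorm b (u n - l) < e.

Definition semi_complete V b : Prop :=
  forall u : nat -> E, (forall n, V (u n)) -> semi_cauchy b u ->
  exists2 l, V l & semi_cvg b u l.

(** For [0 < c], evaluate at the minimizer [- b / c]. For [c = 0] the function is affine in [t], and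
    if [b] were nonzero it would take the value [-1] at [- (a + 1) / (2 * b)]. *)
Lemma quadratic_ge0_discr (a b c : R) : 0 <= c ->
  (forall t, 0 <= a + 2 * t * b + t ^+ 2 * c) -> b ^+ 2 <= a * c.
Proof.
rewrite le_eqVlt => /predU1P[<- h|c0 h].
  have [->|b0] := eqVneq b 0; first by rewrite expr0n/= mulr0.
  have := h (- (a + 1) / (2 * b)).
  have -> : a + 2 * (- (a + 1) / (2 * b)) * b +
            (- (a + 1) / (2 * b)) ^+ 2 * 0 = -1 by field; rewrite b0.
  lra.
have := h (- b / c).
have -> : a + 2 * (- b / c) * b + (- b / c) ^+ 2 * c = a - b ^+ 2 / c.
  by field; rewrite gt_eqF.
by rewrite subr_ge0 ler_pdivrMr.
Qed.

Lemma subspaceD V u v : subspace V -> V u -> V v -> V (u + v).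
Proof. by move=> [_ h] Vu Vv; rewrite -[u]scale1r; exact: h. Qed.

Lemma subspaceZ V (c : R) u : subspace V -> V u -> V (c *: u).
Proof. by move=> [h0 h] Vu; rewrite -[c *: u]addr0; exact: h. Qed.

Lemma subspaceN V u : subspace V -> V u -> V (- u).
Proof. by move=> sV Vu; rewrite -scaleN1r; exact: subspaceZ. Qed.

Lemma subspaceB V u v : subspace V -> V u -> V v -> V (u - v).
Proof. by move=> sV Vu Vv; apply: subspaceD => //; exact: subspaceN. Qed.

Lemma linear_on0 V (L : E -> R) : subspace V -> linear_on V L -> L 0 = 0.
Proof.
by move=> [V0 _] LL; have := LL (-1) 0 0 V0 V0; rewrite scaler0 addr0 mulN1r addNr.
Qed.

Lemma linear_onD V (L : E -> R) u v :
  linear_on V L -> V u -> V v -> L (u + v) = L u + L v.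
Proof. by move=> LL Vu Vv; rewrite -{1}[u]scale1r LL// mul1r. Qed.

Lemma linear_onZ V (L : E -> R) (c : R) u :
  subspace V -> linear_on V L -> V u -> L (c *: u) = c * L u.
Proof.
move=> sV LL Vu; have [V0 _] := sV.
by rewrite -[c *: u]addr0 LL// (linear_on0 sV LL) addr0.
Qed.

Lemma linear_onB V (L : E -> R) u v :
  subspace V -> linear_on V L -> V u -> V v -> L (u - v) = L u - L v.
Proof.
by move=> sV LL Vu Vv; rewrite addrC -scaleN1r LL// mulN1r addrC.
Qed.

Lemma semi_innerS V (W : set E) b : V `<=` W -> semi_inner W b -> semi_inner V b.
Proof.
move=> VW [h1 h2 h3]; split.
- by move=> w /VW Ww c u v /VW Wu /VW Wv; exact: h1.
- by move=> u v /VW Wu /VW Wv; exact: h2.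
- by move=> u /VW Wu; exact: h3.
Qed.

Lemma semi_inner_lin2 V b u v (t : R) : subspace V -> semi_inner V b ->
  V u -> V v ->
  b (u + t *: v) (u + t *: v) = b u u + 2 * t * b u v + t ^+ 2 * b v v.
Proof.
move=> sV [bl bs b0] Vu Vv; have Vuv : V (t *: v + u) by apply sV.
rewrite addrC (bl _ Vuv)// (bs v)// (bs u)// !bl// (bs v u)//.
ring.
Qed.

Lemma cauchy_schwarz_sqr V b u v : subspace V -> semi_inner V b ->
  V u -> V v -> b u v ^+ 2 <= b u u * b v v.
Proof.
move=> sV sb Vu Vv; have [bl bs b0] := sb.
apply: quadratic_ge0_discr => [|t]; first exact: b0.
rewrite -(semi_inner_lin2 _ sV sb)//; apply: b0.
by apply: subspaceD => //; exact: subspaceZ.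
Qed.

Lemma seminorm_ge0 b u : 0 <= seminorm b u.
Proof. exact: sqrtr_ge0. Qed.

Lemma seminorm_sqr V b u : semi_inner V b -> V u -> seminorm b u ^+ 2 = b u u.
Proof. by move=> [_ _ b0] Vu; rewrite sqr_sqrtr// b0. Qed.

Lemma seminorm_lt b u (e : R) : 0 < e -> b u u < e ^+ 2 -> seminorm b u < e.
Proof.
move=> e0 h; rewrite -[ltRHS](gtr0_norm e0) -sqrtr_sqr ltr_sqrt//.
by rewrite exprn_gt0.
Qed.

Lemma seminorm_le b u (e : R) : 0 <= e -> b u u <= e ^+ 2 -> seminorm b u <= e.
Proof.
move=> e0 h; rewrite -[leRHS](ger0_norm e0) -sqrtr_sqr ler_sqrt//.
by rewrite exprn_ge0.
Qed.

Lemma cauchy_schwarz V b u v : subspace V -> semi_inner V b ->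
  V u -> V v -> `|b u v| <= seminorm b u * seminorm b v.
Proof.
move=> sV sb Vu Vv; rewrite -(@ler_pXn2r _ 2)// ?nnegrE ?mulr_ge0 ?seminorm_ge0//.
rewrite exprMn !(seminorm_sqr sb)// real_normK ?num_real//.
exact: cauchy_schwarz_sqr sb _ _.
Qed.

Lemma seminorm0 V b : subspace V -> semi_inner V b -> seminorm b 0 = 0.
Proof.
move=> sV [bl _ _]; have [V0 _] := sV.
by rewrite /seminorm (linear_on0 sV (bl _ V0)) sqrtr0.
Qed.

Lemma seminormD V b u v : subspace V -> semi_inner V b -> V u -> V v ->
  seminorm b (u + v) <= seminorm b u + seminorm b v.
Proof.
move=> sV sb Vu Vv.
rewrite -(@ler_pXn2r _ 2)// ?nnegrE ?addr_ge0 ?seminorm_ge0//.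
have := semi_inner_lin2 1 sV sb Vu Vv; rewrite scale1r => h.
rewrite (seminorm_sqr sb (subspaceD sV Vu Vv)). rewrite h -!(seminorm_sqr sb)//.
have := cauchy_schwarz sV sb Vu Vv; have := ler_norm (b u v).
nra.
Qed.

Lemma seminormZ V b (c : R) u : subspace V -> semi_inner V b -> V u ->
  seminorm b (c *: u) = `|c| * seminorm b u.
Proof.
move=> sV sb Vu; have [bl bs b0] := sb.
have Vcu : V (c *: u) by exact: subspaceZ.
rewrite /seminorm (linear_onZ c sV (bl _ Vcu))// bs// (linear_onZ c sV (bl _ Vu))//.
by rewrite mulrA -expr2 sqrtrM ?sqr_ge0// sqrtr_sqr.
Qed.

Lemma seminormB V b u v : subspace V -> semi_inner V b -> V u -> V v ->
  seminorm b (u - v) = seminorm b (v - u).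
Proof.
move=> sV sb Vu Vv; have Vvu := subspaceB sV Vv Vu.
rewrite -[u - v]opprB -[- (v - u)]scaleN1r (seminormZ _ sV sb Vvu).
by rewrite normrN1 mul1r.
Qed.

Lemma seminorm_tri V b v u w : subspace V -> semi_inner V b ->
  V u -> V v -> V w ->
  seminorm b (u - w) <= seminorm b (u - v) + seminorm b (v - w).
Proof.
move=> sV sb Vu Vv Vw; rewrite -[u](subrK v) -addrA addrK.
apply: (seminormD sV sb); exact: subspaceB.
Qed.

(** The kernel of a bounded functional is closed; this is how the weak gradient identity passes to
    limits. *)
Lemma semi_cvg_ker V b (L : E -> R) (c : R) (u : nat -> E) l : subspace V ->
  linear_on V L -> (forall v, V v -> `|L v| <= c * seminorm b v) ->
  (forall k, V (u k)) -> V l -> semi_cvg b u l -> (forall k, L (u k) = 0) -> L l = 0.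
Proof.
move=> sV LL Lc Vu Vl ul Lu; apply/eqP; rewrite -normr_le0.
apply/ler_addgt0Pr => e e0; rewrite add0r.
have c1 : 0 < `|c| + 1 by rewrite ltr_wpDl.
have ec : 0 < e / (`|c| + 1) by rewrite divr_gt0.
have [N /(_ _ (leqnn N)) HN] := ul _ ec.
have := Lc _ (subspaceB sV (Vu N) Vl).
rewrite (linear_onB sV LL)// Lu sub0r normrN => /le_trans; apply.
rewrite ltr_pdivlMr// in HN; have := ler_norm c.
have := seminorm_ge0 b (u N - l); nra.
Qed.

(* The minimizing sequences of [b v v - 2 * L v] are Cauchy by the parallelogram
   identity. *)
Lemma riesz V b (L : E -> R) (c : R) : subspace V -> semi_inner V b ->
  semi_complete V b -> linear_on V L ->
  (forall v, V v -> `|L v| <= c * seminorm b v) ->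
  exists2 u, V u & forall v, V v -> b u v = L v.
Proof.
move=> sV sb cV LL Lc; have [bl bs b0] := sb; have [V0 _] := sV.
pose J v := b v v - 2 * L v.
have Jlin u v t : V u -> V v ->
    J (u + t *: v) = J u + 2 * t * (b u v - L v) + t ^+ 2 * b v v.
  move=> Vu Vv; rewrite /J (semi_inner_lin2 t sV sb)// (linear_onD LL)//.
    by rewrite (linear_onZ t sV LL)//; ring.
  exact: subspaceZ.
(* With [s] the seminorm of [v], [J v >= s^2 - 2 c s >= - c^2]. *)
have Jlb v : V v -> - c ^+ 2 <= J v.
  move=> Vv; rewrite /J -(seminorm_sqr sb)//.
  have := Lc _ Vv; have := ler_norm (L v); have := sqr_ge0 (seminorm b v - c); nra.
have JI : has_inf (J @` V).
  split; first by exists (J 0), 0.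
  by exists (- c ^+ 2) => _ [v Vv <-]; exact: Jlb.
set m := inf (J @` V).
have mJ v : V v -> m <= J v by move=> Vv; apply: ge_inf; [case: JI|exists v].
have /choice[w Hw] (n : nat) : exists v, V v /\ J v < m + n.+1%:R^-1.
  have n0 : 0 < n.+1%:R^-1 :> R by rewrite invr_gt0.
  have [_ [v Vv <-] h] := inf_adherent n0 JI.
  by exists v.
have Vw n : V (w n) by case: (Hw n).
(* An almost minimizer almost satisfies the Euler equation: the quadratic
   [t |-> J (w n + t *: v) - m] is nonnegative, and its constant term is below [n.+1%:R^-1], so its
   discriminant bounds the residual. *)
have key n v : V v -> (b (w n) v - L v) ^+ 2 <= n.+1%:R^-1 * b v v.
  move=> Vv; apply: (@le_trans _ _ ((J (w n) - m) * b v v)).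
    apply: quadratic_ge0_discr => [|t]; first exact: b0.
    have : m <= J (w n + t *: v).
      by apply: mJ; apply: subspaceD => //; exact: subspaceZ.
    by rewrite Jlin//; lra.
  apply: ler_wpM2r; first exact: b0.
  by have [_ /ltW h] := Hw n; rewrite lerBlDl.
have inv_small (e : R) : 0 < e -> exists N : nat, forall n, (N <= n)%N -> n.+1%:R^-1 < e.
  move=> e0; exists (Num.truncn e^-1) => n Nn.
  rewrite -[e]invrK ltf_pV2 ?posrE ?invr_gt0//.
  by rewrite (lt_le_trans (truncnS_gt _))// ler_nat ltnS.
have cw : semi_cauchy b w.
  (* With [d = w p - w q] and [z] the midpoint of [w p] and [w q],
     [b d d / 2 = J (w p) + J (w q) - 2 * J z]. As [m <= J z], excesses below [e ^+ 2 / 4] give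
     [b d d < e ^+ 2]. *)
  move=> e e0; have e4 : 0 < e ^+ 2 / 4 by rewrite divr_gt0// exprn_gt0.
  have [N HN] := inv_small _ e4.
  exists N => p q Np Nq.
  have Vd : V (w p - w q) by exact: subspaceB.
  have Vm : V (w q + 2^-1 *: (w p - w q)) by apply: subspaceD => //; exact: subspaceZ.
  have := mJ _ Vm; rewrite Jlin// => mm.
  have := Jlin (w q) (w p - w q) 1 (Vw q) Vd; rewrite scale1r addrC subrK => Jp.
  apply: (seminorm_lt e0).
  have [_ h1] := Hw p; have [_ h2] := Hw q; have := HN _ Np; have := HN _ Nq.
  move: (p.+1%:R^-1) (q.+1%:R^-1) h1 h2 => x y; lra.
have [l Vl wl] := cV _ Vw cw.
exists l => // v Vv; apply/eqP; rewrite -subr_eq0 -normr_le0.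
apply/ler_addgt0Pr => e e0; rewrite add0r.
pose s := seminorm b v + 1.
have s0 : 0 < s by rewrite ltr_wpDl ?seminorm_ge0.
have es0 : 0 < e / 2 / s by rewrite !divr_gt0.
have [N1 H1] := inv_small _ (exprn_gt0 2 es0).
have [N2 H2] := wl _ es0.
set n := maxn N1 N2.
have := H1 n (leq_maxl _ _); have := H2 n (leq_maxr _ _) => {H1 H2} h2 h1.
have -> : b l v - L v = (b (w n) v - L v) - b (w n - l) v.
  by rewrite (linear_onB sV (bl _ Vv))//; ring.
apply: (le_trans (ler_normB _ _)); rewrite [leRHS](splitr e) lerD//.
  rewrite -(@ler_pXn2r _ 2)// ?nnegrE ?divr_ge0 ?(ltW e0)// real_normK ?num_real//.
  apply: (le_trans (key _ _ Vv)); rewrite -(seminorm_sqr sb)//.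
  have -> : (e / 2) ^+ 2 = (e / 2 / s) ^+ 2 * s ^+ 2 by field; rewrite gt_eqF.
  apply: ler_pM; rewrite ?invr_ge0 ?sqr_ge0 ?(ltW h1)//.
  by rewrite ler_pXn2r ?nnegrE ?seminorm_ge0 ?(ltW s0)// lerDl.
have Vd : V (w n - l) by exact: subspaceB.
apply: (le_trans (cauchy_schwarz sV sb Vd Vv)).
have -> : e / 2 = (e / 2 / s) * s by field; rewrite gt_eqF.
by apply: ler_pM; rewrite ?seminorm_ge0 ?(ltW h2)// lerDl.
Qed.

End semi_inner_product.

(** * Square-integrable functions *)

Section square_integrable.
Context d (T : measurableType d) (R : realType).
Variables (mu : {measure set T -> \bar R}) (D : set T) (mD : measurable D).
Implicit Types u v w : T -> R.
Local Notation E := (T -> R^o).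

(** [L2] over an arbitrary measure space; for [lebesgue_rV] the two are convertible, which later
    proofs exploit silently. *)
Definition sqint u : Prop :=
  measurable_fun D u /\ mu.-integrable D (fun x => (u x ^+ 2)%:E).

Definition ip2 u v : R := \int[mu]_(x in D) (u x * v x).

Lemma sqintP u : measurable_fun D u ->
  (\int[mu]_(x in D) (u x ^+ 2)%:E < +oo)%E -> sqint u.
Proof.
move=> mu_ h; split => //; apply/integrableP; split.
  exact/measurable_EFinP/measurable_funX.
by under eq_integral do rewrite gee0_abs ?lee_fin ?sqr_ge0//.
Qed.

Lemma sqint_int u : sqint u -> (\int[mu]_(x in D) (u x ^+ 2)%:E = (ip2 u u)%:E)%E.
Proof.
move=> [_ iu]; rewrite /ip2 /Rintegral; under [in RHS]eq_integral do rewrite -expr2.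
by rewrite fineK// integrable_fin_num.
Qed.

Lemma sqintM u v : sqint u -> sqint v ->
  mu.-integrable D (EFin \o (fun x => u x * v x)).
Proof.
move=> [mfu iu] [mfv iv]; have := integrableD mD iu iv.
apply: le_integrable => //; first exact/measurable_EFinP/measurable_funM.
move=> x _ /=; rewrite lee_fin normrM [leRHS]ger0_norm ?addr_ge0 ?sqr_ge0//.
rewrite -(real_normK (num_real (u x))) -(real_normK (num_real (v x))).
have := normr_ge0 (u x); have := normr_ge0 (v x).
have := sqr_ge0 (`|u x| - `|v x|); nra.
Qed.

Lemma sqint_le u v : measurable_fun D u ->
  (forall x, D x -> `|u x| <= `|v x|) -> sqint v -> sqint u.
Proof.
move=> mfu uv [mfv iv]; split => //; apply: le_integrable iv => //.
  exact/measurable_EFinP/measurable_funX.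
move=> x Dx /=; rewrite lee_fin !normrX.
by rewrite ler_pXn2r ?nnegrE//; exact: uv.
Qed.

Lemma sqint_subspace : subspace (sqint : set E).
Proof.
split.
  split; first exact: measurable_cst.
  have -> : (fun x => ((0 : E) x ^+ 2)%:E) = cst 0%E :> (T -> \bar R).
    by apply/funext => x /=; rewrite expr0n.
  exact: integrable0.
move=> c u v su sv; have [mfu iu] := su; have [mfv iv] := sv; split.
  apply: measurable_funD => //.
  by apply: measurable_funM => //; exact: measurable_cst.
have := integrableD mD (integrableD mD (integrableZl mD (c ^+ 2) iu)
  (integrableZl mD (2 * c) (sqintM su sv))) iv.
apply: eq_integrable => // x _ /=.
rewrite -!EFinM -!EFinD; congr EFin.
have -> : ((c *: (u : E) + v) x : R) = c * u x + v x by [].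
ring.
Qed.

Lemma semi_inner_ip2 : semi_inner (sqint : set E) ip2.
Proof.
split.
- move=> w sw c u v su sv; rewrite /ip2 -RintegralZl//; last exact: sqintM.
  rewrite -RintegralD//; [|exact: (integrableZl mD c (sqintM su sw))|exact: sqintM].
  apply: eq_Rintegral => x _.
  have -> : ((c *: (u : E) + v) x : R) = c * u x + v x by [].
  by rewrite mulrDl mulrA.
- by move=> u v _ _; apply: eq_Rintegral => x _; rewrite mulrC.
- by move=> u _; apply: Rintegral_ge0 => x _; rewrite -expr2 sqr_ge0.
Qed.

Lemma ip2_eq0 u : sqint u -> ip2 u u = 0 -> {ae mu, forall x, D x -> u x = 0}.
Proof.
move=> su u0; have := sqint_int su; rewrite u0 => iu0.
have [mfu iu] := su.
have [h _] := @ae_eq_integral_abs _ _ _ mu D mD _ (measurable_int _ iu).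
have /h : (\int[mu]_(x in D) `|(u x ^+ 2)%:E| = 0)%E.
  by rewrite -[RHS]iu0; apply: eq_integral => x _; rewrite gee0_abs// lee_fin sqr_ge0.
apply: filterS => x h0 Dx; have [/eqP] := h0 Dx.
by rewrite sqrf_eq0 => /eqP.
Qed.

(* Along a subsequence with summable [4^k * |u_(k+1) - u_k|^2] the sequence
   converges geometrically almost everywhere; Fatou's lemma then bounds the
   distance to the pointwise limit. *)
Lemma sqint_complete : semi_complete (sqint : set E) ip2.
Proof.
move=> u su cu; have sS := sqint_subspace; have sI := semi_inner_ip2.
(* This rate gives [4 ^+ k * ek k ^+ 2 = 4 ^- k.+1], which is at most the summable [2 ^- k.+1]. *)
pose ek k : R := (2 ^+ k * 2 ^+ k.+1)^-1.
have ek0 k : 0 < ek k by rewrite invr_gt0 mulr_gt0// exprn_gt0.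
have /choice[N HN] k := cu _ (ek0 k).
(* The maximum over all earlier thresholds puts both [nk k] and [nk k.+1] beyond [N k]; the lower
   bound [k] makes [nk] tend to infinity. *)
pose nk k := maxn k (\max_(i < k.+1) N i)%N.
have nkk k : (k <= nk k)%N by exact: leq_maxl.
have Nnk i k : (i <= k)%N -> (N i <= nk k)%N.
  rewrite -ltnS => ik; apply: leq_trans (leq_maxr _ _).
  exact: (@leq_bigmax _ (fun i : 'I_k.+1 => N i) (Ordinal ik)).
pose v k : T -> R := u (nk k.+1) - u (nk k).
have sv k : sqint (v k) by exact: subspaceB.
have vk k : ip2 (v k) (v k) < ek k ^+ 2.
  rewrite -(seminorm_sqr sI)// ltr_pXn2r ?nnegrE ?seminorm_ge0 ?(ltW (ek0 k))//.
  by apply: HN; exact: Nnk.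
pose F k x := ((4 ^+ k) * v k x ^+ 2)%:E.
have F0 k x : D x -> (0 <= F k x)%E.
  by move=> _; rewrite lee_fin mulr_ge0 ?sqr_ge0 ?exprn_ge0.
have mF k : measurable_fun D (F k).
  apply/measurable_EFinP/measurable_funM; first exact: measurable_cst.
  by apply: measurable_funX; exact: (sv k).1.
pose H x := (\sum_(k <oo) F k x)%E.
have mH : measurable_fun D H.
  by apply: ge0_emeasurable_sum => // k x Dx _; exact: F0.
have iH : mu.-integrable D H.
  apply/integrableP; split => //.
  under eq_integral => x /set_mem Dx.
    rewrite gee0_abs; last by apply: nneseries_ge0 => k _ _; exact: F0.
    over.
  rewrite integral_nneseries//.
  apply: (@le_lt_trans _ _ 1%:E); last exact: ltry.
  apply: le_trans (@epsilon_trick0 R 1 xpredT ler01).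
  apply: lee_nneseries => [k _ _|k _].
    by apply: integral_ge0 => x Dx; exact: F0.
  have -> : (\int[mu]_(x in D) F k x = (4 ^+ k * ip2 (v k) (v k))%:E)%E.
    rewrite EFinM -sqint_int// -ge0_integralZl_EFin//.
      by move=> x _; rewrite lee_fin sqr_ge0.
      by apply/measurable_EFinP/measurable_funX; exact: (sv k).1.
  rewrite lee_fin; apply: (@le_trans _ _ (4 ^+ k * ek k ^+ 2)).
    by rewrite ler_pM2l ?exprn_gt0// ltW.
  rewrite /ek invfM exprMn !exprVn mulrA -!exprM mul1r.
  have -> : 4 ^+ k = 2 ^+ (k * 2) :> R by rewrite mulnC exprM expr2 -natrM.
  rewrite divff ?expf_neq0// mul1r natrX lef_pV2 ?posrE ?exprn_gt0//.
  by rewrite ler_eXn2l ?ltr1n// leq_pmulr.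
pose D0 := D `&` H @^-1` [set~ +oo%E].
have mD0 : measurable D0 by apply: mH => //; apply: measurableC.
have D0ae : {ae mu, forall x, D x -> D0 x}.
  apply: filterS (integrable_ae mD iH) => x h Dx; split => // Hx.
  by have := h Dx; rewrite Hx.
(* Cutting off to 0 where the series [H] is infinite makes the sequence converge at every point of
   [D], so its limit is measurable; only a null set is affected. *)
pose w k : T -> R := u (nk k) \_ D0.
have mw k : measurable_fun D (w k).
  apply/(measurable_restrict _ mD0 mD).
  apply: measurable_funS (su (nk k)).1 => //; exact: subIsetr.
have cw x : D x -> cvgn (w ^~ x).
  move=> Dx; have [D0x|nD0x] := pselect (D0 x); last first.
    rewrite (_ : w ^~ x = cst 0); first exact: is_cvg_cst.
    by apply/funext => k; rewrite /w patchE memNset.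
  have -> : w ^~ x = (fun k => u (nk k) x).
    by apply/funext => k; rewrite /w patchE mem_set.
  have -> : (fun k => u (nk k) x) =
      (fun k => u (nk 0%N) x + series (fun k => v k x) k).
    apply/funext => k; rewrite (@eq_sum_telescope _ (fun k => u (nk k) x) k).
    by [].
  apply: is_cvgD; first exact: is_cvg_cst.
  apply: normed_cvg.
  have Hfin : H x \is a fin_num.
    rewrite ge0_fin_numE; first by case: D0x => _; rewrite ltey => /eqP.
    by apply: nneseries_ge0 => k _ _; exact: F0.
  pose h := fine (H x).
  have Fh k : 4 ^+ k * v k x ^+ 2 <= h.
    rewrite -lee_fin /h fineK//.
    rewrite /H (@nneseriesD1 _ (F ^~ x) k xpredT)//; last first.
      by move=> i _; exact: F0.
    rewrite leeDl//; apply: nneseries_ge0 => i _ _; exact: F0.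
  have h0 : 0 <= h by apply: le_trans (Fh 0%N); rewrite expr0 mul1r sqr_ge0.
  (* From [(2 ^+ k * |v k x|) ^+ 2 <= h <= (1 + h) ^+ 2]; the constant [1 + h] replaces the square
     root of [h]. *)
  apply: (@series_le_cvg _ _ (geometric (1 + h) 2^-1)) => //.
  - by move=> k; exact: normr_ge0.
  - by move=> k; rewrite /geometric/= mulr_ge0 ?addr_ge0 ?exprn_ge0.
  - move=> k; rewrite /geometric /= exprVn ler_pdivlMr ?exprn_gt0//.
    rewrite -(@ler_pXn2r _ 2) ?nnegrE ?mulr_ge0 ?addr_ge0 ?exprn_ge0//.
    rewrite exprMn real_normK ?num_real// -exprM mulnC exprM.
    have := Fh k; rewrite (_ : 2 ^+ 2 = 4); last by rewrite expr2 -natrM.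
    nra.
  - apply: is_cvg_geometric_series.
    by rewrite ger0_norm// invf_lt1// ltr1n.
pose l x := limn (w ^~ x).
have ml : measurable_fun D l.
  by apply: (@measurable_fun_cvg _ _ _ _ w) => // x Dx; exact: cw.
have key (e : R) : 0 < e -> exists N, forall n, (N <= n)%N ->
    (\int[mu]_(x in D) ((u n x - l x) ^+ 2)%:E <= (e ^+ 2)%:E)%E.
  move=> e0; have [M HM] := cu _ e0; exists M => n Mn.
  pose un : T -> R := u n.
  pose f k x := ((un x - w k x) ^+ 2)%:E.
  have mf k : measurable_fun D (f k).
    by apply/measurable_EFinP/measurable_funX/measurable_funB => //; exact: (su n).1.
  have f0 k x : D x -> (0 <= f k x)%E by move=> _; rewrite lee_fin sqr_ge0.
  have -> : (\int[mu]_(x in D) ((un x - l x) ^+ 2)%:E =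
             \int[mu]_(x in D) limn_einf (f ^~ x))%E.
    apply: eq_integral => x /set_mem Dx; apply/esym.
    apply: (cvg_limn_einf_sup _).1.
    apply: cvg_EFin; first exact: nearW.
    rewrite /f/=; apply: (@cvgM _ _ _ _ (fun k => un x - w k x) (fun k => un x - w k x));
      by apply: cvgB; [exact: cvg_cst|exact: cw].
  apply: le_trans (fatou mu mD mf f0) _.
  rewrite limn_einf_lim; apply: lime_le; first exact: is_cvg_einfs.
  apply: nearW => p; set q := maxn p M.
  apply: (@le_trans _ _ (\int[mu]_(x in D) f q x)%E).
    by apply: ereal_inf_lbound; exists q => //=; rewrite leq_maxl.
  have sd : sqint (u n - u (nk q)) by exact: subspaceB.
  rewrite (_ : (\int[mu]_(x in D) f q x)%E =
               (ip2 (u n - u (nk q)) (u n - u (nk q)))%:E); last first.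
    rewrite -sqint_int//; apply: ge0_ae_eq_integral => //.
    - exact: (measurable_int _ sd.2).
    - exact: f0.
    - by move=> x _; rewrite lee_fin sqr_ge0.
    - apply: filterS D0ae => x D0x Dx; rewrite /f /w patchE mem_set//.
      exact: D0x.
  rewrite lee_fin -(seminorm_sqr sI)// ler_pXn2r ?nnegrE ?seminorm_ge0 ?(ltW e0)//.
  by apply/ltW/HM => //; apply: leq_trans (nkk q); exact: leq_maxr.
have sl n : measurable_fun D (fun x => (u n x : R) - l x).
  by apply: measurable_funB => //; exact: (su n).1.
exists l => [|e e0].
  have [n /(_ n (leqnn _)) Hn] := key 1 ltr01.
  have -> : l = u n - (fun x => (u n x : R) - l x).
    by apply/funext => x; rewrite /= -[RHS]/(u n x - (u n x - l x)) subKr.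
  apply: subspaceB => //; apply: sqintP => //.
  by apply: le_lt_trans Hn _; exact: ltry.
have e2 : 0 < e / 2 by rewrite divr_gt0.
have [M HM] := key _ e2; exists M => n Mn.
have sd : sqint (fun x => (u n x : R) - l x).
  by apply: sqintP => //; apply: le_lt_trans (HM n Mn) _; exact: ltry.
apply: (@le_lt_trans _ _ (e / 2)); last by rewrite ltr_pdivrMr// ltr_pMr// ltr1n.
apply: seminorm_le; first exact: ltW.
by have := HM n Mn; rewrite (sqint_int sd) lee_fin.
Qed.

End square_integrable.

(** * Borel sets and smooth functions on row vectors *)

Section row_vector_space.
Context (R : realType) (n : nat).
Local Notation X := 'rV[R]_n.
Local Notation mu := (lebesgue_rV R n).

Lemma measurable_ball_rV (x : X) (e : R) : 0 < e -> measurable (ball x e).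
Proof.
move=> e0; rewrite (_ : ball x e =
    \big[setI/setT]_(i < n) ((fun y : X => y 0 i) @^-1` (ball (x 0 i) e))).
  apply: bigsetI_measurable => i _; rewrite -[X in measurable X]setTI.
  by apply: measurable_coord => //; exact: measurable_ball.
rewrite -bigcap_seq; apply/seteqP; split => [y [_ xy] i _ /=|y xy].
  exact: xy.
split=> // i j; rewrite ord1; apply: xy => /=; exact: mem_index_enum.
Qed.

(** The balls of rational center and radius [1 / (m + 1)] that fit into [U] are countably many and
    cover it. Balls of the sup norm are boxes, hence lie in the coordinate sigma-algebra. *)
Lemma open_measurable_rV (U : set X) : open U -> measurable U.
Proof.
move=> oU.
pose B (p : 'rV[rat]_n * nat) : set X := ball (map_mx ratr p.1 : X) p.2.+1%:R^-1.
have mB p : measurable (B p) by apply: measurable_ball_rV; rewrite invr_gt0.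
rewrite (_ : U = \bigcup_p (if pselect (B p `<=` U) then B p else set0)).
  apply: countable_bigcupT_measurable => [|p]; first exact: countableP.
  by case: pselect => h /=; [exact: mB|exact: measurable0].
apply/seteqP; split => [x Ux|x [p _]]; last by case: pselect => // h; exact: h.
have /nbhs_ballP[e /= e0 xeU] : nbhs x U by move: oU; rewrite openE; apply.
(* Two radii must fit into [e]: a small ball that contains [x] without being centered there still
   lies in [ball x e]. *)
pose m := Num.truncn (e / 2)^-1.
have me : m.+1%:R^-1 < e / 2.
  by rewrite -[ltRHS]invrK ltf_pV2 ?posrE ?invr_gt0 ?divr_gt0// truncnS_gt.
have m0 : 0 < m.+1%:R^-1 :> R by rewrite invr_gt0.
have /choice[q Hq] (i : 'I_n) : exists q : rat, `|x 0 i - ratr q| < m.+1%:R^-1.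
  have : x 0 i - m.+1%:R^-1 < x 0 i + m.+1%:R^-1.
    by rewrite ltrD2l; rewrite (lt_trans _ m0)// oppr_lt0.
  move=> /rat_in_itvoo[q]; rewrite in_itv/= => /andP[h1 h2]; exists q.
  move: (m.+1%:R^-1) h1 h2 => r h1 h2.
  by rewrite ltr_norml; apply/andP; split; lra.
have xB : B (\row_i q i, m) x.
  by split => // i j; rewrite ord1 !mxE /=; apply: ball_sym; exact: Hq.
exists (\row_i q i, m) => //; case: pselect => // -[] y yB; apply: xeU.
have := ball_triangle (ball_sym xB) yB; apply: le_ball.
rewrite /=; move: (m.+1%:R^-1) me => r me; lra.
Qed.

Lemma closed_measurable_rV (F : set X) : closed F -> measurable F.
Proof.
move=> cF; rewrite -[F]setCK; apply: measurableC; apply: open_measurable_rV.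
exact: closed_openC.
Qed.

Lemma continuous_measurable_rV (D : set X) (f : X -> R) : continuous f -> measurable_fun D f.
Proof.
move=> /continuousP cf; apply: measurable_funTS.
apply: (measurability _ (RGenOpens.measurableE R)).
move=> _ [_ [a [b ->] <-]]; rewrite setTI; apply: open_measurable_rV.
exact/cf/interval_open.
Qed.

Lemma coord_le_norm (x : X) i : `|x 0 i| <= `|x|.
Proof.
rewrite {2}/Num.norm/= mx_normrE.
by apply: (le_bigmax _ (fun ij : 'I_1 * 'I_n => `|x ij.1 ij.2|) (0, i)).
Qed.

Lemma bounded_setP (D : set X) : bounded_set D -> exists M : R, forall x, D x -> `|x| <= M.
Proof.
move=> [M [_ HM]]; exists (M + 1) => x Dx; apply: HM => //; lra.
Qed.

Lemma bounded_lty (D : set X) : measurable D -> bounded_set D -> (mu D < +oo)%E.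
Proof.
move=> mD /bounded_setP[M DM].
pose B := [set x : X | forall i, `[- M, M]%classic (x 0 i)].
have mB : measurable B.
  rewrite (_ : B = \big[setI/setT]_(i < n) ((fun y : X => y 0 i) @^-1` `[- M, M])).
    by apply: bigsetI_measurable => i _; rewrite -[X in measurable X]setTI;
      exact: measurable_coord.
  rewrite -bigcap_seq; apply/seteqP; split => [y yB i _|y yB i]; first exact: yB.
  by apply: yB => /=; exact: mem_index_enum.
apply: (@le_lt_trans _ _ (mu B)).
  apply: le_measure; rewrite ?inE// => x Dx i /=.
  rewrite in_itv/= -ler_norml (le_trans (coord_le_norm _ _))//; exact: DM.
rewrite (@lebesgue_rV_box R n (fun=> `[- M, M]%classic))//.
rewrite -ge0_fin_numE; last by apply: prode_ge0 => i _.
apply: prode_fin_num => i _; rewrite lebesgue_measure_itv/=.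
by case: ifPn.
Qed.

Lemma continuous_bounded_on (D : set X) (f : X -> R) : bounded_set D -> continuous f ->
  exists M : R, forall x, D x -> `|f x| <= M.
Proof.
move=> /bounded_setP[M DM] cf.
pose B := [set x : X | `|x| <= M].
have cB : closed B.
  rewrite (_ : B = (fun x : X => `|x|) @^-1` [set y | y <= M])//.
  by apply: closed_comp => [x _|]; [exact: norm_continuous|exact: closed_le].
have bB : bounded_set B.
  exists M; split; first exact: num_real.
  by move=> y My x /= xM; exact: le_trans xM (ltW My).
have /compact_bounded/= : compact (f @` B).
  apply: continuous_compact; first by apply: continuous_subspaceT.
  exact: bounded_closed_compact.
move=> [N [_ HN]]; exists (N + 1) => x Dx; apply: HN; first lra.
by exists x => //; exact: DM.
Qed.

Lemma bounded_sqint (D : set X) (u : X -> R) (M : R) : measurable D -> bounded_set D ->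
  measurable_fun D u -> (forall x, D x -> `|u x| <= M) -> sqint mu D u.
Proof.
move=> mD bD mfu uM; apply: (@sqint_le _ _ _ _ _ mD _ (cst M)) => //.
  by move=> x Dx; rewrite (le_trans (uM _ Dx))// ler_norm.
split; first exact: measurable_cst.
rewrite (_ : (fun=> _) = cst (M ^+ 2)%:E)//.
apply/integrableP; split; first exact: measurable_cst.
rewrite (eq_integral (cst `|M ^+ 2|%:E))// integral_cst// lte_mul_pinfty//.
exact: bounded_lty.
Qed.

Lemma continuous_sqint (D : set X) (u : X -> R) : measurable D -> bounded_set D ->
  continuous u -> sqint mu D u.
Proof.
move=> mD bD cu; have [M uM] := continuous_bounded_on bD cu.
exact: bounded_sqint (continuous_measurable_rV cu) uM.
Qed.

(** * Linear combinations of smooth functions *)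

Lemma partial_lin (c : R) (u v : X -> R) i x :
  derivable u x (delta_mx 0 i) -> derivable v x (delta_mx 0 i) ->
  partial i (fun x => c * u x + v x) x = c * partial i u x + partial i v x.
Proof.
move=> du dv; rewrite /partial.
have -> : (fun x => c * u x + v x) = (c \*: u : X -> R) + v by [].
have dcu : derivable (c \*: u : X -> R) x (delta_mx 0 i) by exact: derivableZ.
by rewrite (deriveD dcu dv) (deriveZ c du).
Qed.

Lemma foldr_partial_lin (c : R) (u v : X -> R) l : smooth u -> smooth v ->
  foldr (@partial R n) (fun x => c * u x + v x) l =
  (fun x => c * foldr (@partial R n) u l x + foldr (@partial R n) v l x).
Proof.
move=> su sv; elim: l => [//|i l ih]; rewrite [LHS]/= ih.
apply/funext => x; apply: partial_lin; [exact: (su l).1|exact: (sv l).1].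
Qed.

Lemma smooth_lin (c : R) (u v : X -> R) : smooth u -> smooth v ->
  smooth (fun x => c * u x + v x).
Proof.
move=> su sv l; rewrite foldr_partial_lin//; split => [i x|x].
  have -> : (fun x => c * foldr (@partial R n) u l x + foldr (@partial R n) v l x) =
    (c \*: foldr (@partial R n) u l : X -> R) + foldr (@partial R n) v l by [].
  by apply: derivableD; [apply: derivableZ; exact: (su l).1|exact: (sv l).1].
have cu := (su l).2 x; have cv := (sv l).2 x.
exact: (cvgD (cvgM (cvg_cst c) cu) cv).
Qed.

Lemma gradient_lin (c : R) (u v : X -> R) : smooth u -> smooth v ->
  gradient (fun x => c * u x + v x) = (fun x => c *: gradient u x + gradient v x).
Proof.
move=> su sv; apply/funext => x; apply/rowP => i; rewrite !mxE.
by apply: partial_lin; [exact: (su [::]).1|exact: (sv [::]).1].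
Qed.

Lemma smooth0 : smooth (fun _ : X => 0 : R).
Proof.
have h l : foldr (@partial R n) (fun _ => 0) l = (fun _ => 0).
  elim: l => [//|i l ih]; rewrite /= ih; apply/funext => x.
  exact: derive_cst.
move=> l; rewrite h; split => [i x|x]; first exact: derivable_cst.
exact: cst_continuous.
Qed.

Lemma gradient0 : gradient (fun _ : X => 0 : R) = (fun=> 0).
Proof.
by apply/funext => x; apply/rowP => i; rewrite !mxE; exact: derive_cst.
Qed.

Lemma fsupport_lin (c : R) (u v : X -> R) :
  fsupport (fun x => c * u x + v x) `<=` fsupport u `|` fsupport v.
Proof.
rewrite /fsupport -closureU; apply: closureS => x /=.
have [->|u0 _] := eqVneq (u x) 0; last by left.
by rewrite mulr0 add0r; right.
Qed.

End row_vector_space.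

(** * The Sobolev space of pairs (function, weak gradient) *)

(** Integrability is proved together with the value because additivity of the real-valued integral
    requires it in the induction. *)
Lemma Rintegral_sum d (T : measurableType d) (R : realType) (mu : {measure set T -> \bar R})
    (D : set T) (I : Type) (s : seq I) (f : I -> T -> R) : measurable D ->
  (forall i, mu.-integrable D (EFin \o f i)) ->
  mu.-integrable D (EFin \o (fun x => \sum_(i <- s) f i x)) /\
  \int[mu]_(x in D) (\sum_(i <- s) f i x) = \sum_(i <- s) \int[mu]_(x in D) f i x.
Proof.
move=> mD intf; elim: s => [|i s [ih1 ih2]].
  under eq_fun do rewrite big_nil; split.
    by rewrite (_ : _ \o _ = cst 0%E)//; exact: integrable0.
  by rewrite big_nil Rintegral_cst// mul0r.
under eq_fun do rewrite big_cons; split.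
  exact: (integrableD mD (intf i) ih1).
by rewrite big_cons -ih2 RintegralD.
Qed.

Section sobolev_pairs.
Context (R : realType) (n : nat).
Local Notation X := 'rV[R]_n.
Local Notation mu := (lebesgue_rV R n).
Local Notation E := ((X -> R^o) * (X -> X))%type.
Variables (D G : set X).
Local Notation nrm2 := (seminorm (ip2 mu D : (X -> R^o) -> (X -> R^o) -> R)).
Hypotheses (mD : measurable D) (bD : bounded_set D).
Implicit Types (u v w : E) (psi phi : X -> R).

Let comp u (i : 'I_n) : X -> R := fun x => u.2 x 0 i.

(** The ambient space L^2 x (L^2)^n, with no relation between the two components. Its completeness
    is inherited componentwise, and [pairH1z] is a closed subspace of it. *)
Definition pairL2 : set E :=
  [set u : E | sqint mu D u.1 /\ forall i : 'I_n, sqint mu D (fun x : X => u.2 x 0 i)].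

Definition ipH u v : R := ip2 mu D u.1 v.1 +
  \sum_i ip2 mu D (fun x => u.2 x 0 i) (fun x => v.2 x 0 i).

Definition jet psi : E := (psi, gradient psi).

Definition pairH1z : set E := [set u : E | H1_zero D G u.1 u.2].

Let comp_lin (c : R) u v i :
  comp (c *: u + v) i = c *: (comp u i : X -> R^o) + (comp v i : X -> R^o).
Proof. by apply/funext => x; rewrite /comp /= !mxE. Qed.

Let comp_sub u v i :
  (fun x => (u - v).2 x 0 i) = (comp u i : X -> R^o) - (comp v i : X -> R^o).
Proof. by apply/funext => x; rewrite /comp /= !mxE. Qed.

Lemma pairL2_subspace : subspace pairL2.
Proof.
have [s0 s1] := sqint_subspace mu mD; split.
  split=> [|i]; first exact: s0.
  rewrite (_ : (fun _ => _) = 0 :> (X -> R^o)); first exact: s0.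
  by apply/funext => x; rewrite /= mxE.
move=> c u v [u1 u2] [v1 v2]; split => [|i]; first exact: s1.
by have := s1 c _ _ (u2 i) (v2 i); rewrite -comp_lin.
Qed.

Lemma semi_inner_ipH : semi_inner pairL2 ipH.
Proof.
have [s1 s2 s3] := semi_inner_ip2 mu mD; split.
- move=> w [w1 w2] c u v [u1 u2] [v1 v2]; rewrite /ipH (s1 _ w1)//.
  rewrite mulrDr addrACA; congr +%R; rewrite mulr_sumr -big_split/=.
  by apply: eq_bigr => i _; rewrite -(s1 _ (w2 i))// -comp_lin.
- move=> u v [u1 u2] [v1 v2]; rewrite /ipH s2//; congr +%R.
  by apply: eq_bigr => i _; rewrite s2.
- by move=> u [u1 u2]; rewrite addr_ge0 ?s3// sumr_ge0// => i _; rewrite s3.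
Qed.

Lemma ip2_le_ipH u : pairL2 u -> ip2 mu D u.1 u.1 <= ipH u u.
Proof.
have [s1 s2 s3] := semi_inner_ip2 mu mD.
by move=> [u1 u2]; rewrite lerDl sumr_ge0// => i _; rewrite s3.
Qed.

Lemma ip2_comp_le_ipH u i : pairL2 u ->
  ip2 mu D (fun x => u.2 x 0 i) (fun x => u.2 x 0 i) <= ipH u u.
Proof.
have [s1 s2 s3] := semi_inner_ip2 mu mD.
move=> [u1 u2]; rewrite /ipH (bigD1 i)//= addrCA lerDl addr_ge0 ?s3//.
by rewrite sumr_ge0// => j _; rewrite s3.
Qed.

Lemma pairL2_complete : semi_complete pairL2 ipH.
Proof.
have c2 := @sqint_complete _ _ _ mu D mD; have pS := pairL2_subspace.
have pI := semi_inner_ipH.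
move=> u su cu.
have [] := c2 (fun k => (u k).1).
- by move=> k; case: (su k).
- move=> e /cu[N HN]; exists N => p q Np Nq.
  have upq : pairL2 (u p - u q) by exact: subspaceB.
  apply: le_lt_trans (HN _ _ Np Nq).
  exact: (ler_wsqrtr (ip2_le_ipH upq)).
move=> l0 sl0 cl0.
have H i : exists l : X -> R, sqint mu D l /\
    semi_cvg (ip2 mu D : (X -> R^o) -> (X -> R^o) -> R) (fun k => comp (u k) i) l.
  have [] := c2 (fun k => comp (u k) i).
  - by move=> k; have [_] := su k; apply.
  - move=> e /cu[N HN]; exists N => p q Np Nq.
    have upq : pairL2 (u p - u q) by exact: subspaceB.
    have := ler_wsqrtr (ip2_comp_le_ipH i upq); rewrite comp_sub => h.
    exact: le_lt_trans h (HN _ _ Np Nq).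
  by move=> l sl cl; exists l.
have {H} /choice[l Hl] := H.
pose L : E := (l0, fun x => \row_i l i x).
have cL i : (fun x => L.2 x 0 i) = l i by apply/funext => x; rewrite /= mxE.
have sL : pairL2 L.
  by split => [//|i]; rewrite cL; case: (Hl i).
exists L => // e e0.
(* There are [n.+1] components, and [n.+1 * (e / n.+2) ^+ 2 < e ^+ 2]. *)
have e'0 : 0 < e / n.+2%:R by rewrite divr_gt0.
have [N0 HN0] := cl0 _ e'0.
have /choice[N HN] (i : 'I_n) : exists N, forall k, (N <= k)%N ->
    nrm2 (comp (u k) i - l i) < e / n.+2%:R.
  exact: (Hl i).2 _ e'0.
exists (maxn N0 (\max_i N i)) => k; rewrite geq_max => /andP[k0 /bigmax_leqP kN].
have sk : pairL2 (u k - L) by exact: subspaceB.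
apply: seminorm_lt => //.
have sq (x : X -> R) : sqint mu D x ->
    nrm2 x < e / n.+2%:R ->
    ip2 mu D x x <= (e / n.+2%:R) ^+ 2.
  move=> sx h; rewrite -(seminorm_sqr (semi_inner_ip2 mu mD) sx).
  by rewrite ler_pXn2r ?nnegrE ?seminorm_ge0 ?(ltW e'0) ?(ltW h).
apply: (@le_lt_trans _ _ ((e / n.+2%:R) ^+ 2 + \sum_(i < n) (e / n.+2%:R) ^+ 2)).
  apply: lerD; first by apply: sq; [case: sk|exact: HN0].
  apply: ler_sum => i _; apply: sq; first by have [_] := sk; apply.
  by rewrite comp_sub [comp L i]cL; apply: HN; exact: kN.
rewrite sumr_const card_ord -mulrS -[_ *+ n.+1]mulr_natr [(e / _) ^+ 2]expr_div_n mulrAC.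
rewrite ltr_pdivrMr ?exprn_gt0// ltr_pM2l ?exprn_gt0// -natrX ltr_nat.
by rewrite expnS expn1 mulnS ltn_addr// ltnS.
Qed.

Lemma smooth_sqint psi : smooth psi -> sqint mu D psi.
Proof. by move=> s; apply: continuous_sqint => //; exact: (s [::]).2. Qed.

Lemma smooth_partial_sqint psi i : smooth psi -> sqint mu D (partial i psi).
Proof. by move=> s; apply: continuous_sqint => //; exact: (s [:: i]).2. Qed.

Lemma jet_pairL2 psi : smooth psi -> pairL2 (jet psi).
Proof.
move=> s; split => [|i]; first exact: smooth_sqint.
rewrite (_ : (fun x => _) = partial i psi); first exact: smooth_partial_sqint.
by apply/funext => x; rewrite /= mxE.
Qed.

Lemma integral_dot u : pairL2 u ->
  \int[mu]_(x in D) dot (u.2 x) (u.2 x) =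
  \sum_i ip2 mu D (fun x => u.2 x 0 i) (fun x => u.2 x 0 i).
Proof.
move=> [_ u2]; rewrite /dot.
by apply: (Rintegral_sum _ mD _).2 => i; exact: sqintM.
Qed.

Lemma H1normE u : pairL2 u -> H1norm D u.1 u.2 = seminorm ipH u.
Proof.
by move=> su; rewrite /H1norm /seminorm /ipH integral_dot.
Qed.

Definition approximable u : Prop := forall e : R, 0 < e ->
  exists psi, [/\ smooth psi, fsupport psi `&` G = set0 &
    seminorm ipH (u - jet psi) < e].

Lemma pairH1zP u : pairH1z u <-> H1 D u.1 u.2 /\ approximable u.
Proof.
split=> -[h1 h2]; split => // e e0; have [psi [p1 p2 p3]] := h2 _ e0;
  exists psi; split => //; [rewrite -H1normE//|rewrite -H1normE// in p3];
  by apply: (subspaceB pairL2_subspace); [case: h1|exact: jet_pairL2].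
Qed.

Lemma pairH1z_pairL2 : pairH1z `<=` pairL2.
Proof. by move=> u [[h1 h2 _] _]. Qed.

Lemma jet_lin (c : R) psi phi : smooth psi -> smooth phi ->
  jet (fun x => c * psi x + phi x) = c *: jet psi + jet phi.
Proof. by move=> s1 s2; rewrite /jet gradient_lin. Qed.

Lemma pairH1z_subspace : subspace pairH1z.
Proof.
have [t1 t2 t3] := semi_inner_ip2 mu mD; have sS := sqint_subspace mu mD.
have pS := pairL2_subspace; have pI := semi_inner_ipH.
split.
  apply/pairH1zP; split.
    have [s1 s2] := pS.1; split => //.
    move=> phi [sphi _ _] i.
    have l0 (v : X -> R) : sqint mu D v -> ip2 mu D (fun=> 0) v = 0.
      by move=> sv; exact: (linear_on0 sS (t1 v sv)).
    rewrite -[LHS]/(ip2 mu D (fun=> 0) (partial i phi)) l0; last exact: smooth_partial_sqint.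
    rewrite (_ : (fun x => _) = (fun x => 0 * phi x)); last first.
      by apply/funext => x; rewrite /= mxE.
    by rewrite -/(ip2 mu D (fun=> 0) phi) l0 ?oppr0//; exact: smooth_sqint.
  move=> e e0; exists (fun=> 0); split; first exact: smooth0.
    rewrite /fsupport (_ : [set x | _] = set0) ?closure0 ?set0I//.
    by apply/seteqP; split => x //=; rewrite eqxx.
  have -> : (0 : E) - jet (fun=> 0) = 0 by rewrite /jet gradient0 subrr.
  by rewrite (seminorm0 pS pI).
move=> c u v Hu Hv.
have [[u1 u2 u3] u4] := (pairH1zP u).1 Hu; have [[v1 v2 v3] v4] := (pairH1zP v).1 Hv.
have Lu := pairH1z_pairL2 Hu; have Lv := pairH1z_pairL2 Hv.
apply/pairH1zP; split.
  have [w1 w2] := pS.2 c u v Lu Lv; split => // phi tphi i.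
  have [sphi _ _] := tphi.
  have sp := smooth_sqint sphi; have sdp := smooth_partial_sqint i sphi.
  have wu : ip2 mu D u.1 (partial i phi) = - ip2 mu D (comp u i) phi := u3 phi tphi i.
  have wv : ip2 mu D v.1 (partial i phi) = - ip2 mu D (comp v i) phi := v3 phi tphi i.
  rewrite -[LHS]/(ip2 mu D (c *: u + v).1 (partial i phi)).
  rewrite -[RHS]/(- ip2 mu D (comp (c *: u + v) i) phi) comp_lin.
  rewrite [LHS](t1 _ sdp c u.1 v.1 u1 v1) (t1 _ sp c _ _ (u2 i) (v2 i)).
  by rewrite wu wv; ring.
move=> e e0.
have c1 : 0 < `|c| + 1 by rewrite ltr_wpDl.
have e1 : 0 < e / 2 / (`|c| + 1) by rewrite !divr_gt0.
have [p1 [sp1 fp1 hp1]] := u4 _ e1.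
have [p2 [sp2 fp2 hp2]] := v4 (e / 2) ltac:(by rewrite divr_gt0).
exists (fun x => c * p1 x + p2 x); split; first exact: smooth_lin.
  apply/seteqP; split => // x [/fsupport_lin[h|h] Gx]; first by rewrite -fp1.
  by rewrite -fp2.
have d1 : pairL2 (u - jet p1) by apply: subspaceB => //; exact: jet_pairL2.
have d2 : pairL2 (v - jet p2) by apply: subspaceB => //; exact: jet_pairL2.
have -> : c *: u + v - jet (fun x => c * p1 x + p2 x) =
          c *: (u - jet p1) + (v - jet p2).
  by rewrite jet_lin// opprD scalerBr addrACA.
apply: (le_lt_trans (seminormD pS pI (subspaceZ c pS d1) d2)).
rewrite (seminormZ _ pS pI)//; rewrite ltr_pdivlMr// in hp1.
rewrite [ltRHS](splitr e) ltrD//; apply: le_lt_trans hp1.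
by rewrite mulrC ler_wpM2l ?seminorm_ge0// lerDl.
Qed.

(** Closedness in [pairL2]: for each test function and index, the weak gradient identity says that a
    bounded functional [F] vanishes, and approximability passes to limits by the triangle
    inequality. *)
Lemma pairH1z_complete : semi_complete pairH1z ipH.
Proof.
have sS := sqint_subspace mu mD; have sI := semi_inner_ip2 mu mD.
have [t1 _ _] := sI.
have pS := pairL2_subspace; have pI := semi_inner_ipH.
move=> u Hu cu; have Lu k := pairH1z_pairL2 (Hu k).
have [l Ll ul] := pairL2_complete Lu cu; exists l => //; apply/pairH1zP.
have [l1 l2] := Ll; split.
  split => // phi tphi i; have [sphi _ _] := tphi.
  have sp := smooth_sqint sphi; have sdp := smooth_partial_sqint i sphi.
  pose F (w : E) := ip2 mu D w.1 (partial i phi) + ip2 mu D (comp w i) phi.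
  have linF : linear_on pairL2 F.
    move=> c v w [v1 v2] [w1 w2]; rewrite /F comp_lin.
    rewrite [X in X + _ = _](t1 _ sdp c v.1 w.1 v1 w1) (t1 _ sp c _ _ (v2 i) (w2 i)).
    ring.
  have bF w : pairL2 w -> `|F w| <= (nrm2 (partial i phi) +
      nrm2 phi) * seminorm ipH w.
    move=> Lw; have [w1 w2] := Lw; apply: (le_trans (ler_normD _ _)).
    rewrite mulrDl; apply: lerD; rewrite mulrC.
      apply: (le_trans (cauchy_schwarz sS sI w1 sdp)); apply: ler_wpM2r.
        exact: seminorm_ge0.
      exact: (ler_wsqrtr (ip2_le_ipH Lw)).
    apply: (le_trans (cauchy_schwarz sS sI (w2 i) sp)); apply: ler_wpM2r.
      exact: seminorm_ge0.
    exact: (ler_wsqrtr (ip2_comp_le_ipH i Lw)).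
  have Fu k : F (u k) = 0.
    have [[_ _ h] _] := Hu k.
    by rewrite /F [X in X + _](h phi tphi i) addNr.
  have := semi_cvg_ker pS linF bF Lu Ll ul Fu.
  by rewrite /F => /eqP; rewrite addr_eq0 => /eqP.
move=> e e0; have e2 : 0 < e / 2 by rewrite divr_gt0.
have [N /(_ _ (leqnn N)) HN] := ul _ e2.
have [psi [s1 s2 s3]] := ((pairH1zP _).1 (Hu N)).2 _ e2.
exists psi; split => //.
apply: (le_lt_trans (seminorm_tri pS pI Ll (Lu N) (jet_pairL2 s1))).
rewrite [ltRHS](splitr e); apply: ltrD s3.
by rewrite (seminormB pS pI Ll (Lu N)).
Qed.

End sobolev_pairs.

(** * The energy form *)

Lemma lipschitz_const_continuous (R : realType) (V : normedModType R) (f : V -> R) (k : R) :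
  (forall x y, `|f x - f y| <= k * `|x - y|) -> continuous f.
Proof.
move=> fk x; apply/cvgrPdist_lt => e e0.
have k1 : 0 < `|k| + 1 by rewrite ltr_wpDl.
near=> y; apply: le_lt_trans (fk _ _) _.
apply: (@le_lt_trans _ _ ((`|k| + 1) * `|x - y|)).
  by apply: ler_wpM2r => //; rewrite (le_trans (ler_norm _))// lerDl.
rewrite mulrC -ltr_pdivlMr//.
near: y; have /cvgrPdist_lt := @cvg_id _ (nbhs x); apply; exact: divr_gt0.
Unshelve. all: by end_near. Qed.

Section energy.
Context (R : realType) (n : nat).
Local Notation X := 'rV[R]_n.
Local Notation mu := (lebesgue_rV R n).
Local Notation E := ((X -> R^o) * (X -> X))%type.
Variables (D G : set X) (A : X -> 'M[R]_n) (eps glow gup M Cp : R).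
Local Notation nrm2 := (seminorm (ip2 mu D : (X -> R^o) -> (X -> R^o) -> R)).
Hypotheses (mD : measurable D) (bD : bounded_set D) (M0 : 0 < M).
Hypotheses (hA : coefficient A glow gup) (Cp0 : 0 < Cp) (hP : poincare D G Cp).
Implicit Types (u v w : E).

Let glow0 : 0 < glow. Proof. by case: hA => _ _ _ _ []. Qed.
Let gup0 : 0 < gup. Proof. by case: hA => _ _ _ _ []. Qed.

Definition flux u v (x : X) : R :=
  \sum_i \sum_j A (eps^-1 *: x) i j * u.2 x 0 j * v.2 x 0 i.

(** The left-hand side of one iteration step. The term in [M] controls the function itself, so the
    seminorm is equivalent to that of [ipH] and inherits its completeness. *)
Definition energy u v : R := diffusion D A eps u.2 v.2 + M * ip2 mu D u.1 v.1.

Definition gradsq u : R := \int[mu]_(x in D) dot (u.2 x) (u.2 x).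

Lemma coefficient_continuous i j : continuous (fun x : X => A (eps^-1 *: x) i j).
Proof.
have [_ _ _ /(_ i j)[k [_ hk']] _] := hA.
(* [lipschitz] provides the bound for every constant strictly above [k]. *)
have /hk' hk : k < k + 1 by rewrite ltrDl.
apply: (@lipschitz_const_continuous _ _ _ ((k + 1) * `|eps^-1|)) => x y.
have := hk (eps^-1 *: x, eps^-1 *: y) ltac:(by []).
by rewrite /= -scalerBr normrZ mulrA.
Qed.

(** The coefficients are continuous, hence bounded on the bounded set [D], and each term is a
    product of two square-integrable functions. *)
Lemma flux_integrable u v : pairL2 D u -> pairL2 D v ->
  mu.-integrable D (EFin \o flux u v).
Proof.
move=> [_ u2] [_ v2].
have H i j : mu.-integrable D
    (EFin \o (fun x => A (eps^-1 *: x) i j * u.2 x 0 j * v.2 x 0 i)).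
  apply: (@sqintM _ _ _ mu _ mD (fun x => A (eps^-1 *: x) i j * u.2 x 0 j)); last exact: v2.
  have [C HC] := continuous_bounded_on bD (@coefficient_continuous i j).
  apply: (@sqint_le _ _ _ mu _ mD _ (C *: ((fun x => u.2 x 0 j) : X -> R^o))).
  - apply: measurable_funM; last by case: (u2 j).
    apply: continuous_measurable_rV; exact: coefficient_continuous.
  - move=> x Dx; rewrite -[X in `|X| <= _]/(_ * _) normrM.
    rewrite -[leRHS]/(`|C * u.2 x 0 j|) normrM ler_wpM2r//.
    by rewrite (le_trans (HC _ Dx))// ler_norm.
  - by apply: subspaceZ; [exact: sqint_subspace|exact: u2].
apply: (Rintegral_sum _ mD _).1 => i.
by apply: (Rintegral_sum _ mD _).1 => j.
Qed.

Lemma flux_sym u v x : flux u v x = flux v u x.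
Proof.
have [_ _ As _ _] := hA.
rewrite /flux exchange_big; apply: eq_bigr => i _; apply: eq_bigr => j _.
by rewrite -{1}As mxE mulrAC.
Qed.

Lemma flux_lin (c : R) u v w x : flux (c *: u + v) w x = c * flux u w x + flux v w x.
Proof.
rewrite /flux mulr_sumr -big_split; apply: eq_bigr => i _ /=.
rewrite mulr_sumr -big_split; apply: eq_bigr => j _ /=.
by rewrite !mxE; ring.
Qed.

Lemma flux_bounds u x :
  glow * dot (u.2 x) (u.2 x) <= flux u u x <= gup * dot (u.2 x) (u.2 x).
Proof.
have [_ _ _ _ [_ _ /(_ (eps^-1 *: x) (u.2 x))]] := hA.
rewrite (_ : flux u u x =
  \sum_i \sum_j A (eps^-1 *: x) i j * u.2 x 0 i * u.2 x 0 j)//.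
by apply: eq_bigr => i _; apply: eq_bigr => j _; rewrite mulrAC.
Qed.

Lemma diffusion_lin w : pairL2 D w ->
  linear_on (pairL2 D) (fun u => diffusion D A eps u.2 w.2).
Proof.
move=> Lw c u v Lu Lv.
rewrite -[LHS]/(\int[mu]_(x in D) flux (c *: u + v) w x).
under eq_Rintegral do rewrite flux_lin.
have iu := flux_integrable Lu Lw; have iv := flux_integrable Lv Lw.
by rewrite RintegralD//; [rewrite RintegralZl|exact: (integrableZl mD c iu)].
Qed.

Lemma diffusion_bounds u : pairL2 D u ->
  glow * gradsq u <= diffusion D A eps u.2 u.2 <= gup * gradsq u.
Proof.
move=> Lu; have iu := flux_integrable Lu Lu.
have idot : mu.-integrable D (EFin \o (fun x => dot (u.2 x) (u.2 x))).
  by apply: (Rintegral_sum _ mD _).1 => i; apply: sqintM => //; case: Lu.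
rewrite -!RintegralZl//; apply/andP; split; apply: le_Rintegral => //.
- exact: (integrableZl mD glow idot).
- by move=> x _; have /andP[] := flux_bounds u x.
- exact: (integrableZl mD gup idot).
- by move=> x _; have /andP[] := flux_bounds u x.
Qed.

Lemma gradsq_ge0 u : 0 <= gradsq u.
Proof.
by apply: Rintegral_ge0 => x _; apply: sumr_ge0 => i _; rewrite -expr2 sqr_ge0.
Qed.

Lemma ipH_gradsq u : pairL2 D u -> ipH D u u = ip2 mu D u.1 u.1 + gradsq u.
Proof. by move=> Lu; rewrite /gradsq integral_dot. Qed.

Lemma semi_inner_energy : semi_inner (pairL2 D) energy.
Proof.
have [s1 s2 s3] := semi_inner_ip2 mu mD; split.
- move=> w Lw c u v Lu Lv; rewrite /energy (diffusion_lin Lw)//.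
  rewrite (s1 _ Lw.1 c u.1 v.1 Lu.1 Lv.1); ring.
- move=> u v Lu Lv; rewrite /energy (s2 _ _ Lu.1 Lv.1); congr (_ + _).
  by apply: eq_Rintegral => x _; exact: flux_sym.
- move=> u Lu; rewrite /energy addr_ge0// ?mulr_ge0 ?s3 ?(ltW M0)//; last by case: Lu.
  have /andP[+ _] := diffusion_bounds Lu; apply: le_trans.
  by rewrite mulr_ge0 ?gradsq_ge0 ?(ltW glow0).
Qed.

Let m := Num.min glow M.
Let m0 : 0 < m. Proof. by rewrite lt_min glow0. Qed.

Lemma energy_ge u : pairL2 D u -> m * ipH D u u <= energy u u.
Proof.
move=> Lu; have /andP[h _] := diffusion_bounds Lu.
have [_ _ s3] := semi_inner_ip2 mu mD; have := s3 _ Lu.1 => h0.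
rewrite ipH_gradsq// mulrDr addrC /energy lerD//.
  by apply: le_trans h; rewrite ler_wpM2r ?gradsq_ge0// ge_min lexx.
by rewrite ler_wpM2r// ge_min lexx orbT.
Qed.

Lemma energy_le u : pairL2 D u -> energy u u <= (gup + M) * ipH D u u.
Proof.
move=> Lu; have /andP[_ h] := diffusion_bounds Lu.
have [_ _ s3] := semi_inner_ip2 mu mD; have h0 := s3 _ Lu.1.
rewrite ipH_gradsq// /energy mulrDr addrC lerD//.
  by rewrite ler_wpM2r// lerDr ltW.
by apply: (le_trans h); rewrite ler_wpM2r ?gradsq_ge0// lerDl ltW.
Qed.

Lemma seminorm_energy_le u : pairL2 D u ->
  seminorm energy u <= Num.sqrt (gup + M) * seminorm (ipH D) u.
Proof.
move=> Lu; rewrite /seminorm -sqrtrM; last by rewrite addr_ge0 ?ltW.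
by apply: ler_wsqrtr; exact: energy_le.
Qed.

Lemma seminorm_energy_ge u : pairL2 D u ->
  Num.sqrt m * seminorm (ipH D) u <= seminorm energy u.
Proof.
move=> Lu; rewrite /seminorm -sqrtrM; last exact: ltW.
by apply: ler_wsqrtr; exact: energy_ge.
Qed.

Lemma energy_complete : semi_complete (pairH1z D G) energy.
Proof.
move=> u Hu cu; have Lu k : pairL2 D (u k) := pairH1z_pairL2 (Hu k).
have pS := pairL2_subspace mD.
have sm0 : 0 < Num.sqrt m by rewrite sqrtr_gt0.
have sM0 : 0 < Num.sqrt (gup + M) by rewrite sqrtr_gt0 addr_gt0.
have [|l Hl ul] := pairH1z_complete mD bD Hu.
  move=> e e0; have [N HN] := cu _ (mulr_gt0 sm0 e0); exists N => p q Np Nq.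
  rewrite -(ltr_pM2l sm0); apply: le_lt_trans (HN _ _ Np Nq).
  exact: (seminorm_energy_ge (subspaceB pS (Lu p) (Lu q))).
exists l => // e e0; have [N HN] := ul _ (divr_gt0 e0 sM0).
exists N => k Nk; have := HN _ Nk; rewrite ltr_pdivlMr// mulrC; apply: le_lt_trans.
exact: (seminorm_energy_le (subspaceB pS (Lu k) (pairH1z_pairL2 Hl))).
Qed.

Lemma energy_riesz (F : X -> R) : sqint mu D F ->
  exists2 u, pairH1z D G u & forall v, pairH1z D G v -> energy u v = ip2 mu D F v.1.
Proof.
move=> sF; have sS := sqint_subspace mu mD; have sI := semi_inner_ip2 mu mD.
have [t1 t2 _] := sI.
(* The constant comes from Cauchy-Schwarz in L^2 and [M * ip2 mu D v.1 v.1 <= energy v v]. *)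
apply: (@riesz _ _ _ _ _ (nrm2 F / Num.sqrt M)
  (pairH1z_subspace G mD bD) (semi_innerS (@pairH1z_pairL2 _ _ _ _) semi_inner_energy)
  energy_complete).
  move=> c u v /pairH1z_pairL2[u1 _] /pairH1z_pairL2[v1 _].
  rewrite (t2 _ _ sF (sS.2 c _ _ u1 v1)) (t1 _ sF c _ _ u1 v1).
  by rewrite (t2 _ _ sF u1) (t2 _ _ sF v1).
move=> v /pairH1z_pairL2 Lv; have [v1 _] := Lv.
apply: (le_trans (cauchy_schwarz sS sI sF v1)).
rewrite -mulrA ler_wpM2l ?seminorm_ge0// mulrC ler_pdivlMr ?sqrtr_gt0//.
rewrite mulrC /seminorm -sqrtrM ?(ltW M0)//; apply: ler_wsqrtr.
rewrite /energy lerDr; have /andP[+ _] := diffusion_bounds Lv; apply: le_trans.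
by rewrite mulr_ge0 ?gradsq_ge0 ?(ltW glow0).
Qed.

Let q := glow * Cp^-1 + M.
Let q0 : 0 < q. Proof. by rewrite addr_gt0// mulr_gt0// invr_gt0. Qed.

(** The Poincare inequality turns the gradient part into [glow * Cp^-1] times the squared L^2 norm.
    The resulting constant [q] is the denominator of the contraction factor. *)
Lemma energy_coercive u : pairH1z D G u -> q * ip2 mu D u.1 u.1 <= energy u u.
Proof.
move=> Hu; have Lu := pairH1z_pairL2 Hu; have /andP[h _] := diffusion_bounds Lu.
rewrite /q mulrDl /energy lerD2r; apply: le_trans h.
rewrite -mulrA ler_wpM2l ?(ltW glow0)// mulrC ler_pdivrMr// mulrC.
exact: (hP Hu).
Qed.

(** Testing with [u] itself, with [a] and [b] the L^2 norms of [u] and [F]: coercivity gives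
    [q * a ^+ 2 <= b * a], so [q * a <= b]; then the squared H^1 norm is at most
    [b * a / m <= b ^+ 2 / (m * q)]. *)
Lemma energy_stability u (F : X -> R) : pairH1z D G u -> sqint mu D F ->
  energy u u = ip2 mu D F u.1 ->
  q * nrm2 u.1 <=
    nrm2 F /\
  seminorm (ipH D) u <=
    (Num.sqrt (m * q))^-1 * nrm2 F.
Proof.
move=> Hu sF uF; have Lu := pairH1z_pairL2 Hu.
have sS := sqint_subspace mu mD; have sI := semi_inner_ip2 mu mD.
have pI := semi_inner_ipH mD.
have cF := cauchy_schwarz sS sI sF Lu.1.
have h1 := energy_coercive Hu; have h2 := energy_ge Lu; rewrite uF in h1 h2.
rewrite -(seminorm_sqr sI Lu.1) in h1; rewrite -(seminorm_sqr pI Lu) in h2.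
set a := seminorm _ u.1 in h1 cF *; set b := seminorm _ F in cF *.
have a0 : 0 <= a by exact: seminorm_ge0.
have b0 : 0 <= b by exact: seminorm_ge0.
have h3 : ip2 mu D F u.1 <= b * a := le_trans (ler_norm _) cF.
set s := seminorm _ u in h2 *.
have s0 : 0 <= s by exact: seminorm_ge0.
have qa : q * a <= b.
  have [->|an0] := eqVneq a 0; first by rewrite mulr0.
  have ap : 0 < a by rewrite lt_neqAle eq_sym an0.
  by rewrite -(ler_pM2r ap) -mulrA -expr2; exact: le_trans h1 h3.
split => //.
have mq0 : 0 < m * q by rewrite mulr_gt0.
rewrite mulrC ler_pdivlMr ?sqrtr_gt0// -(@ler_pXn2r _ 2) ?nnegrE ?mulr_ge0 ?sqrtr_ge0//.
rewrite exprMn [X in _ * X]sqr_sqrtr ?(ltW mq0)//.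
apply: (@le_trans _ _ (q * (b * a))).
  by rewrite mulrC -mulrA mulrCA ler_pM2l//; exact: le_trans h2 h3.
by rewrite mulrCA expr2 ler_wpM2l.
Qed.

End energy.

(** * Slopes and geometric estimates *)

Section scalar.
Context {R : realType}.
Implicit Types (F : R -> R) (a : nat -> R).

(** A derivative-free form of [0 <= F' <= l], monotonicity and the Lipschitz bound at once, which
    survives uniform limits. *)
Definition slope_within (l : R) F : Prop :=
  forall s t, s <= t -> 0 <= F t - F s <= l * (t - s).

Lemma derive_slope_within (l : R) F :
  (forall x, derivable F x 1 /\ 0 <= derive1 F x <= l) -> slope_within l F.
Proof.
move=> dF s t st.
have [||c _ ->] := @MVT_segment R F (derive1 F) s t st.
- by move=> x _; rewrite derive1E; apply: derivableP; case: (dF x).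
- by apply: derivable_within_continuous => x _; case: (dF x).
have [_ /andP[c0 cl]] := dF c.
by rewrite mulr_ge0 ?subr_ge0// ler_wpM2r// subr_ge0.
Qed.

Lemma slope_within_lim (l : R) F :
  (forall e : R, 0 < e -> exists2 H, slope_within l H & forall x, `|F x - H x| <= e) ->
  slope_within l F.
Proof.
move=> FH s t st; apply/andP; split; apply/ler_addgt0Pr => e e0.
- have [H /(_ s t st)/andP[H0 Hl] h] := FH (e / 2) ltac:(by rewrite divr_gt0).
  have := h s; have := h t; rewrite !ler_norml => /andP[h1 h2] /andP[h3 h4]; lra.
- have [H /(_ s t st)/andP[H0 Hl] h] := FH (e / 2) ltac:(by rewrite divr_gt0).
  have := h s; have := h t; rewrite !ler_norml => /andP[h1 h2] /andP[h3 h4]; lra.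
Qed.

Lemma slope_within_lipschitz (l : R) F s t :
  slope_within l F -> `|F s - F t| <= l * `|s - t|.
Proof.
move=> hF; have [st|/ltW ts] := leP s t.
  have /andP[h0 hl] := hF _ _ st.
  by rewrite distrC ger0_norm// distrC ger0_norm// subr_ge0.
by have /andP[h0 hl] := hF _ _ ts; rewrite !ger0_norm// subr_ge0.
Qed.

Lemma expr_small (rho B e : R) : 0 <= rho < 1 -> 0 < e ->
  exists N : nat, forall k : nat, (N <= k)%N -> B * rho ^+ k < e.
Proof.
move=> /andP[r0 r1] e0.
have B1 : 0 < `|B| + 1 by rewrite ltr_wpDl.
have /cvgrPdist_lt/(_ _ (divr_gt0 e0 B1))[N _ HN] : rho ^+ k @[k --> \oo] --> 0.
  by apply: cvg_expr; rewrite ger0_norm.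
exists N => k Nk; have := HN k Nk.
rewrite sub0r normrN normrX (ger0_norm r0) ltr_pdivlMr// mulrC; apply: le_lt_trans.
by rewrite ler_wpM2r ?exprn_ge0// (le_trans (ler_norm _))// lerDl.
Qed.

(** Both terms of the recursion are multiples of [B * rho ^+ k]: the first with factor [p], the
    second with factor at most [omega] since [c <= B] and [omega <= rho]. The factors add up to at
    most [rho], which is why the smallness condition involves a sum. *)
Lemma geometric_recursion a (p omega rho c B : R) :
  0 <= p -> 0 <= omega -> p + omega <= rho -> 0 <= c <= B -> a 0%N <= B ->
  (forall k, a k.+1 <= p * a k + c * omega ^+ k.+1) ->
  forall k, a k <= B * rho ^+ k.
Proof.
move=> p0 w0 pw /andP[c0 cB] a0 ak; elim=> [|k ih]; first by rewrite expr0 mulr1.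
have rw : omega <= rho by apply: le_trans pw; rewrite lerDr.
have r0 : 0 <= rho := le_trans w0 rw.
apply: (le_trans (ak k)); apply: (@le_trans _ _ (B * rho ^+ k * (p + omega))).
  rewrite mulrDr; apply: lerD; first by rewrite mulrC ler_wpM2r.
  rewrite exprSr mulrA ler_wpM2r//; apply: ler_pM => //; first exact: exprn_ge0.
  by rewrite lerXn2r ?nnegrE.
by rewrite exprSr [leRHS]mulrA ler_wpM2l// mulr_ge0 ?exprn_ge0//; exact: le_trans cB.
Qed.

End scalar.

Lemma semi_cauchy_geometric {R : realType} {E : lmodType R} (V : set E)
    (b : E -> E -> R) (u : nat -> E) (B rho : R) : subspace V -> semi_inner V b ->
  (forall k, V (u k)) -> 0 <= rho < 1 ->
  (forall k, seminorm b (u k.+1 - u k) <= B * rho ^+ k) -> semi_cauchy b u.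
Proof.
move=> sV sb Vu /[dup] rho01 /andP[r0 r1] hu e e0.
have r1' : 0 < 1 - rho by rewrite subr_gt0.
have B0 : 0 <= B.
  by have := hu 0%N; rewrite expr0 mulr1; apply: le_trans; exact: seminorm_ge0.
(* In this telescoped form the induction step is an identity: [B * rho ^+ j = B / (1 - rho) * (rho
   ^+ j - rho ^+ j.+1)] for every [j]. *)
have H n j : seminorm b (u (n + j)%N - u n) <=
    B / (1 - rho) * (rho ^+ n - rho ^+ (n + j)).
  elim: j => [|j ih]; first by rewrite addn0 !subrr (seminorm0 sV sb) mulr0.
  have := seminorm_tri sV sb (Vu (n + j.+1)%N) (Vu (n + j)%N) (Vu n).
  move=> /le_trans; apply; rewrite addnS.
  apply: (le_trans (lerD (hu _) ih)); rewrite exprS.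
  rewrite le_eqVlt; apply/orP; left; apply/eqP; field.
  by rewrite gt_eqF.
have [N HN] := expr_small (B / (1 - rho)) rho01 e0.
have H' p q : (N <= q)%N -> (q <= p)%N -> seminorm b (u p - u q) < e.
  move=> Nq qp; apply: le_lt_trans (HN q Nq).
  rewrite -(subnKC qp); apply: (le_trans (H _ _)).
  by rewrite ler_wpM2l ?divr_ge0 ?(ltW r1')// gerBl exprn_ge0.
exists N => p q Np Nq; have [qp|/ltnW pq] := leqP q p; first exact: H'.
by rewrite (seminormB sV sb)//; exact: H'.
Qed.

(** * The iteration and its fixed points *)

Section fixed_point.
Context (R : realType) (n : nat).
Local Notation X := 'rV[R]_n.
Local Notation mu := (lebesgue_rV R n).
Local Notation E := ((X -> R^o) * (X -> X))%type.
Variables (D G : set X) (A : X -> 'M[R]_n) (eps glow gup M Cp : R) (f : X -> R).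
Hypotheses (mD : measurable D) (bD : bounded_set D) (M0 : 0 < M).
Hypotheses (hA : coefficient A glow gup) (Cp0 : 0 < Cp) (hP : poincare D G Cp).
Hypothesis (sf : sqint mu D f).
Implicit Types (u v w : E) (S : R -> R) (x y : X -> R).

Local Notation b := (energy D A eps M).
Local Notation nrm2 := (seminorm (ip2 mu D : (X -> R^o) -> (X -> R^o) -> R)).
Local Notation q := (glow * Cp^-1 + M).

Let glow0 : 0 < glow. Proof. by case: hA => _ _ _ _ []. Qed.
Let q0 : 0 < q. Proof. by rewrite addr_gt0// mulr_gt0// invr_gt0. Qed.
Let sS := sqint_subspace mu mD.
Let sI := semi_inner_ip2 mu mD.
Let pS := pairL2_subspace mD.
Let pI := semi_inner_ipH mD.
Let hS := pairH1z_subspace G mD bD.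
Let hI : semi_inner (pairH1z D G) (ipH D) := semi_innerS (@pairH1z_pairL2 _ _ D G) pI.
Let bI : semi_inner (pairH1z D G) b :=
  semi_innerS (@pairH1z_pairL2 _ _ D G) (semi_inner_energy eps mD bD M0 hA).

Lemma const_sqint (c : R) : sqint mu D (fun=> c).
Proof. by apply: (@bounded_sqint _ _ _ _ `|c|) => //; exact: measurable_cst. Qed.

Lemma nrm2_le x y : sqint mu D x -> sqint mu D y ->
  (forall t, D t -> `|x t| <= `|y t|) -> nrm2 x <= nrm2 y.
Proof.
move=> sx sy xy; apply: ler_wsqrtr; apply: le_Rintegral => //; try exact: sqintM.
move=> t Dt; rewrite -!expr2 -[leLHS]real_normK ?num_real// -[leRHS]real_normK ?num_real//.
by rewrite ler_pXn2r ?nnegrE//; exact: xy.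
Qed.

Lemma norm_sqint x : sqint mu D x -> sqint mu D (fun t => `|x t|).
Proof.
move=> sx; apply: (sqint_le mD _ _ sx); last by move=> t _; rewrite normr_id.
by have [mx _] := sx; exact: measurableT_comp.
Qed.

Lemma nrm2_norm x : nrm2 (fun t => `|x t|) = nrm2 x.
Proof.
congr Num.sqrt; apply: eq_Rintegral => t _.
by rewrite -expr2 real_normK ?num_real// expr2.
Qed.

(** The function is dominated by [l * |x| + |S 0|], and constants are square-integrable because [D]
    is bounded. *)
Lemma lip_sqint (l : R) S x : 0 <= l -> (forall s t, `|S s - S t| <= l * `|s - t|) ->
  sqint mu D x -> sqint mu D (fun t => S (x t)).
Proof.
move=> l0 lS sx.
apply: (sqint_le mD (v := l *: ((fun t => `|x t|) : X -> R^o) + (fun=> `|S 0|))).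
- apply: measurableT_comp; last by case: sx.
  by apply: continuous_measurable_fun; exact: lipschitz_const_continuous lS.
- move=> t _; rewrite -[X in _ <= `|X|]/(l * `|x t| + `|S 0|).
  rewrite [leRHS]ger0_norm ?addr_ge0 ?mulr_ge0//.
  have := lS (x t) 0; rewrite subr0 => h.
  by rewrite -[S (x t)](subrK (S 0)) (le_trans (ler_normD _ _))// lerD2r.
- by apply: sS.2; [exact: norm_sqint|exact: const_sqint].
Qed.

(** [nrm2 (fun=> 1)] is the square root of the measure of [D]; it converts a uniform error, such as
    that of a regularization, into an L^2 error. *)
Lemma nrm2_affine x (c : R) y : sqint mu D x -> sqint mu D y -> 0 <= c ->
  (forall t, D t -> `|y t| <= M * `|x t| + c) ->
  nrm2 y <= M * nrm2 x + c * nrm2 (fun=> 1).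
Proof.
move=> sx sy c0 yx.
have s1 := const_sqint 1; have sx' := norm_sqint sx.
pose ax : X -> R^o := fun t => `|x t|.
pose one : X -> R^o := fun=> 1.
have sz : sqint mu D (M *: ax + c *: one).
  by apply: sS.2 => //; exact: (subspaceZ c sS s1).
apply: (@le_trans _ _ (nrm2 (M *: ax + c *: one))).
  apply: nrm2_le => // t Dt; apply: (le_trans (yx t Dt)).
  by rewrite -[X in _ <= `|X|]/(M * `|x t| + c * 1) mulr1 ler_norm.
apply: (le_trans (seminormD sS sI (subspaceZ M sS sx') (subspaceZ c sS s1))).
rewrite (seminormZ M sS sI sx') (seminormZ c sS sI s1).
by rewrite /ax nrm2_norm (gtr0_norm M0) (ger0_norm c0).
Qed.

(** Keeping [S] abstract lets one estimate serve the regularized iteration, where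
    [S s = M * s - kappa * Rg k s], and the iteration with [Rf]. A fixed point of the latter is a
    weak solution. *)
Definition step S w u : Prop :=
  pairH1z D G u /\ forall v, pairH1z D G v -> b u v = ip2 mu D (fun t => f t + S (w.1 t)) v.1.

(** The conclusion concerns the shifted sequence because only square-integrability of the function
    part is asked of [u 0]: [iteration] prescribes [u 0] but not [g 0]. *)
Lemma iterates_cauchy (S : nat -> R -> R) (c omega : R) (u : nat -> E) :
  0 <= c -> 0 < omega -> omega + Num.sqrt (M / q) < 1 ->
  (forall k s t, (0 < k)%N -> `|S k s - S k t| <= M * `|s - t|) ->
  (forall k s, (0 < k)%N -> `|S k.+1 s - S k s| <= c * omega ^+ k) ->
  sqint mu D (u 0%N).1 -> (forall k, step (S k.+1) (u k) (u k.+1)) ->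
  semi_cauchy (ipH D) (fun k => u k.+1).
Proof.
move=> c0 w0 rho1 lS dS su0 hu.
have Hu k : pairH1z D G (u k.+1) by case: (hu k).
have su k : sqint mu D (u k).1 by case: k => // k; have [] := pairH1z_pairL2 (Hu k).
pose N k := nrm2 ((u k.+1).1 - (u k).1).
pose F k : X -> R := fun t => S k.+2 ((u k.+1).1 t) - S k.+1 ((u k).1 t).
have sSu k : sqint mu D (fun t => S k.+1 ((u k).1 t)).
  by apply: (lip_sqint (ltW M0)) => // s t; exact: lS.
have sF k : sqint mu D (F k) by exact: (subspaceB sS (sSu k.+1) (sSu k)).
have sd k : sqint mu D ((u k.+1).1 - (u k).1) by exact: (subspaceB sS (su _) (su _)).
have He k : pairH1z D G (u k.+2 - u k.+1) by exact: subspaceB.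
have eqF k : b (u k.+2 - u k.+1) (u k.+2 - u k.+1) = ip2 mu D (F k) (u k.+2 - u k.+1).1.
  have [bl _ _] := bI; rewrite (linear_onB hS (bl _ (He k)))//.
  have [_ h1] := hu k.+1; have [_ h2] := hu k; rewrite h1// h2//.
  have [tl _ _] := sI; have [se _] := pairH1z_pairL2 (He k).
  have sfS j : sqint mu D (fun t => f t + S j.+1 ((u j).1 t)).
    exact: (subspaceD sS sf (sSu j)).
  rewrite -(linear_onB sS (tl _ se) (sfS k.+1) (sfS k)); congr (ip2 _ _ _ _).
  apply/funext => t; rewrite /F.
  rewrite -[LHS]/((f t + S k.+2 ((u k.+1).1 t)) - (f t + S k.+1 ((u k).1 t))).
  by rewrite opprD addrACA subrr add0r.
pose c1 := c * nrm2 (fun=> 1).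
have c10 : 0 <= c1 by rewrite mulr_ge0 ?seminorm_ge0.
have FN k : nrm2 (F k) <= M * N k + c1 * omega ^+ k.+1.
  rewrite /c1 mulrAC; apply: nrm2_affine => //; first by rewrite mulr_ge0 ?exprn_ge0 ?(ltW w0).
  move=> t _; rewrite /F.
  (* Inserting [S k.+2] at the older iterate separates the Lipschitz contribution from the change of
     nonlinearity at a fixed point. *)
  rewrite -[S k.+2 _](subrK (S k.+2 ((u k).1 t))) -addrA.
  by apply: (le_trans (ler_normD _ _)); apply: lerD; [exact: lS|exact: dS].
have stab k := energy_stability (eps := eps) mD bD M0 hA Cp0 hP (He k) (sF k) (eqF k).
set rho := omega + Num.sqrt (M / q) in rho1.
have Mq0 : 0 <= M / q by rewrite divr_ge0 ?(ltW M0)// (ltW q0).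
(* The contraction factor is [M / q] itself; it is at most its square root because the latter is
   below 1, so the hypothesis with the square root suffices. *)
have Mq : M / q <= Num.sqrt (M / q).
  have s1 : Num.sqrt (M / q) < 1 by apply: le_lt_trans rho1; rewrite lerDr ltW.
  rewrite -{1}(sqr_sqrtr Mq0) expr2 ler_piMr ?sqrtr_ge0//; exact: ltW.
have rho01 : 0 <= rho < 1 by rewrite rho1 andbT addr_ge0 ?sqrtr_ge0// ltW.
have wrho : omega <= rho by rewrite lerDl sqrtr_ge0.
(* Large enough for both the initial difference and the error constant left after division by
   [q]. *)
pose B := N 0%N + c1 / q.
have B0 : 0 <= B by rewrite addr_ge0 ?seminorm_ge0// divr_ge0// ltW.
have NB k : N k <= B * rho ^+ k.
  apply: (@geometric_recursion _ N (M / q) omega rho (c1 / q)) => //.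
  - exact: ltW.
  - by rewrite addrC lerD2l.
  - by rewrite divr_ge0 ?(ltW q0)//= lerDr seminorm_ge0.
  - by rewrite lerDl divr_ge0 ?(ltW q0).
  move=> j; have [+ _] := stab j; move=> /le_trans/(_ (FN j)) h.
  rewrite -(ler_pM2l q0); apply: (le_trans h).
  have qn : q != 0 by rewrite gt_eqF.
  by rewrite mulrDr mulrA [q * (M / q)]mulrC divfK// mulrA [q * (c1 / q)]mulrC divfK.
pose K := (Num.sqrt (Num.min glow M * q))^-1.
apply: (@semi_cauchy_geometric _ _ (pairH1z D G) _ _ (K * (M * B + c1)) rho) => //.
move=> k; have [_ h] := stab k; apply: (le_trans h).
rewrite -mulrA ler_wpM2l ?invr_ge0 ?sqrtr_ge0//; apply: (le_trans (FN k)).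
rewrite mulrDl -mulrA lerD// ?ler_wpM2l ?(ltW M0)//.
have w1 : omega <= 1 by apply: le_trans wrho _; case/andP: rho01 => _ /ltW.
rewrite exprS; apply: (@le_trans _ _ (omega ^+ k)).
  by rewrite ler_piMl ?exprn_ge0 ?(ltW w0).
by rewrite lerXn2r ?nnegrE ?(ltW w0)//; case/andP: rho01.
Qed.

(** * Existence and uniqueness of fixed points *)

Lemma step_exists S w : (forall s t, `|S s - S t| <= M * `|s - t|) ->
  sqint mu D w.1 -> exists u, step S w u.
Proof.
move=> lS sw; have sSw := lip_sqint (ltW M0) lS sw.
have sF : sqint mu D (fun t => f t + S (w.1 t)) by exact: (subspaceD sS sf sSw).
by have [u Hu hu] := energy_riesz G eps mD bD M0 hA sF; exists u.
Qed.

Lemma fixed_point_exists S : (forall s t, `|S s - S t| <= M * `|s - t|) ->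
  Num.sqrt (M / q) < 1 -> exists u, step S u u.
Proof.
move=> lS q1.
(* The implication makes [next] total, with an arbitrary value off the square-integrable pairs; the
   iterates from 0 never leave them. *)
have /choice[next Hnext] w : exists u, sqint mu D w.1 -> step S w u.
  have [sw|nsw] := pselect (sqint mu D w.1); last by exists w.
  by have [u hu] := step_exists lS sw; exists u.
pose u k := iter k next (0 : E).
have su k : sqint mu D (u k).1.
  elim: k => [|k ih]; first exact: sS.1.
  by have [/pairH1z_pairL2[]] := Hnext _ ih.
have hu k : step S (u k) (u k.+1) by exact: Hnext.
(* With a constant nonlinearity the error constant is 0, so any positive [omega] that keeps the sum
   below 1 will do. *)
pose omega := (1 - Num.sqrt (M / q)) / 2.
have w0 : 0 < omega by rewrite divr_gt0// subr_gt0.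
have cu : semi_cauchy (ipH D) (fun k => u k.+1).
  apply: (@iterates_cauchy (fun=> S) 0 omega) => //.
  - rewrite /omega; lra.
  - by move=> k s _; rewrite subrr normr0 mul0r.
have Hu k : pairH1z D G (u k.+1) by case: (hu k).
have [l Hl ul] := pairH1z_complete mD bD Hu cu.
have Ll := pairH1z_pairL2 Hl; have [sl _] := Ll.
exists l; split => // v Hv; have Lv := pairH1z_pairL2 Hv; have [sv _] := Lv.
have [bl _ _] := bI; have [tl _ _] := sI.
have sSl := lip_sqint (ltW M0) lS sl.
have sSu k := lip_sqint (ltW M0) lS (su k).
pose K := Num.sqrt (gup + M) * seminorm b v + M * nrm2 v.1 + 1.
have K0 : 0 < K.
  by rewrite ltr_wpDl// addr_ge0 ?mulr_ge0 ?seminorm_ge0 ?sqrtr_ge0 ?(ltW M0).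
apply/eqP; rewrite -subr_eq0 -normr_le0; apply/ler_addgt0Pr => e e0; rewrite add0r.
have [N HN] := ul _ (divr_gt0 e0 K0).
set d := e / K in HN.
have h1 := HN N (leqnn _); have h2 := HN N.+1 (leqnSn _).
have [_ hv] := hu N.+1; have {hv} := hv _ Hv => hv.
have Hd : pairH1z D G (u N.+2 - l) := subspaceB hS (Hu N.+1) Hl.
have Hd' : pairH1z D G (u N.+1 - l) := subspaceB hS (Hu N) Hl.
have sfS k : sqint mu D (fun t => f t + S ((u k).1 t)) by exact: (subspaceD sS sf (sSu k)).
have sfSl : sqint mu D (fun t => f t + S (l.1 t)) by exact: (subspaceD sS sf sSl).
(* Subtracting the equation of [u N.+2] splits the residual of the limit into a source increment,
   controlled by [u N.+1 - l], and an energy term in [u N.+2 - l]. *)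
have -> : b l v - ip2 mu D (fun t => f t + S (l.1 t)) v.1 =
  ip2 mu D ((fun t => f t + S ((u N.+1).1 t)) - (fun t => f t + S (l.1 t)) : X -> R^o) v.1
  - b (u N.+2 - l) v.
  rewrite (linear_onB hS (bl _ Hv) (Hu N.+1) Hl) hv.
  rewrite (linear_onB sS (tl _ sv) (sfS N.+1) sfSl); ring.
apply: (le_trans (ler_normB _ _)).
have sdf := subspaceB sS (sfS N.+1) sfSl.
have i1 := cauchy_schwarz sS sI sdf sv.
have i2 := cauchy_schwarz hS bI Hd Hv.
have i3 := seminorm_energy_le eps mD bD M0 hA (pairH1z_pairL2 Hd).
have [sd' _] := pairH1z_pairL2 Hd'.
have i4 := nrm2_affine sd' sdf (lexx 0).
have {}i4 : nrm2 ((fun t => f t + S ((u N.+1).1 t)) - (fun t => f t + S (l.1 t)) : X -> R^o)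
    <= M * nrm2 (u N.+1 - l).1.
  apply: (le_trans (i4 _)); last by rewrite mul0r addr0.
  move=> t _; rewrite addr0.
  rewrite -[X in `|X| <= _]/((f t + S ((u N.+1).1 t)) - (f t + S (l.1 t))).
  by rewrite opprD addrACA subrr add0r; exact: lS.
have i5 : nrm2 (u N.+1 - l).1 <= seminorm (ipH D) (u N.+1 - l).
  exact: (ler_wsqrtr (ip2_le_ipH mD (pairH1z_pairL2 Hd'))).
apply: (@le_trans _ _ (M * d * nrm2 v.1 + Num.sqrt (gup + M) * d * seminorm b v)).
  apply: lerD.
    apply: (le_trans i1); apply: ler_wpM2r; first exact: seminorm_ge0.
    apply: (le_trans i4); apply: ler_wpM2l; first exact: ltW.
    exact: (le_trans i5 (ltW h1)).
  apply: (le_trans i2); apply: ler_wpM2r; first exact: seminorm_ge0.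
  apply: (le_trans i3); apply: ler_wpM2l; first exact: sqrtr_ge0.
  exact: ltW.
have -> : e = d * K by rewrite /d mulfVK// gt_eqF.
have d0 : 0 < d by rewrite divr_gt0.
have -> : M * d * nrm2 v.1 + Num.sqrt (gup + M) * d * seminorm b v = d * (K - 1).
  by rewrite /K; ring.
by rewrite ler_pM2l// gerBl.
Qed.

(** Stability and the Lipschitz bound give [q * a <= M * a] for the L^2 norm [a] of the difference,
    and [q] exceeds [M] by [glow * Cp^-1 > 0]. *)
Lemma step_unique S u v : (forall s t, `|S s - S t| <= M * `|s - t|) ->
  step S u u -> step S v v -> {ae mu, forall t, D t -> v.1 t = u.1 t}.
Proof.
move=> lS [Hu hu] [Hv hv].
have Hd : pairH1z D G (v - u) := subspaceB hS Hv Hu.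
have [su _] := pairH1z_pairL2 Hu; have [sv _] := pairH1z_pairL2 Hv.
have [sd _] := pairH1z_pairL2 Hd.
have sSu := lip_sqint (ltW M0) lS su; have sSv := lip_sqint (ltW M0) lS sv.
have sfu : sqint mu D (fun t => f t + S (u.1 t)) := subspaceD sS sf sSu.
have sfv : sqint mu D (fun t => f t + S (v.1 t)) := subspaceD sS sf sSv.
pose F : X -> R^o := (fun t => f t + S (v.1 t)) - (fun t => f t + S (u.1 t)).
have sF : sqint mu D F := subspaceB sS sfv sfu.
have [bl _ _] := bI; have [tl _ _] := sI.
have eqF : b (v - u) (v - u) = ip2 mu D F (v - u).1.
  rewrite (linear_onB hS (bl _ Hd) Hv Hu) hv// hu//.
  by rewrite -(linear_onB sS (tl _ sd) sfv sfu).
have [h1 _] := energy_stability (eps := eps) mD bD M0 hA Cp0 hP Hd sF eqF.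
have h2 : nrm2 F <= M * nrm2 (v - u).1.
  apply: (le_trans (nrm2_affine sd sF (lexx 0) _)); last by rewrite mul0r addr0.
  move=> t _; rewrite addr0 -[X in `|X| <= _]/((f t + S (v.1 t)) - (f t + S (u.1 t))).
  by rewrite opprD addrACA subrr add0r; exact: lS.
have d0 : nrm2 (v - u).1 = 0.
  have := le_trans h1 h2; rewrite mulrDl gerDr pmulr_rle0; last first.
    by rewrite mulr_gt0// invr_gt0.
  by move=> h; apply/eqP; rewrite eq_le h seminorm_ge0.
have := ip2_eq0 mD sd; rewrite -(seminorm_sqr sI sd) d0 expr0n/= => /(_ erefl).
by apply: filterS => t h Dt; apply/eqP; rewrite -subr_eq0; apply/eqP; exact: h.
Qed.

(** Expanding the source by linearity yields the equation of [iteration]; for [w = u] the terms in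
    [M] cancel and the weak formulation remains. *)
Lemma stepP (l kappa : R) (r : R -> R) w u : 0 <= l ->
  (forall s t, `|r s - r t| <= l * `|s - t|) -> sqint mu D w.1 ->
  step (fun s => M * s - kappa * r s) w u <->
  pairH1z D G u /\ forall v, pairH1z D G v ->
    diffusion D A eps u.2 v.2 + M * ip2 mu D u.1 v.1 =
    ip2 mu D f v.1 + M * ip2 mu D w.1 v.1 - kappa * ip2 mu D (fun t => r (w.1 t)) v.1.
Proof.
move=> l0 lr sw; have sr := lip_sqint l0 lr sw; have [tl _ _] := sI.
have H v : pairH1z D G v -> ip2 mu D (fun t => f t + (M * w.1 t - kappa * r (w.1 t))) v.1 =
    ip2 mu D f v.1 + M * ip2 mu D w.1 v.1 - kappa * ip2 mu D (fun t => r (w.1 t)) v.1.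
  move=> /pairH1z_pairL2[sv _].
  have e1 := tl _ sv M w.1 f sw sf; have sMw := sS.2 M w.1 f sw sf.
  have e2 := tl _ sv (- kappa) (fun t => r (w.1 t)) (M *: (w.1 : X -> R^o) + f) sr sMw.
  transitivity (ip2 mu D (- kappa *: ((fun t => r (w.1 t)) : X -> R^o)
      + (M *: (w.1 : X -> R^o) + f)) v.1); last by rewrite e2 e1; ring.
  apply: eq_Rintegral => t _; congr (_ * _).
  rewrite -[RHS]/(- kappa * r (w.1 t) + (M * w.1 t + f t)); ring.
split=> -[Hu hu]; split => // v Hv; first exact: (etrans (hu v Hv) (H v Hv)).
exact: (etrans (hu v Hv) (esym (H v Hv))).
Qed.

End fixed_point.

(** * The perforated domain and the conclusion *)

(** Each removed copy is the preimage of the closed set [T] under an affine map, and the lattice is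
    countable. *)
Lemma perforated_measurable (R : realType) (d : nat) (eps : R) (T Om : set 'rV[R]_d)
    (K : set 'rV[int]_d) : 0 < eps -> closed T -> open Om ->
  measurable (perforated eps T Om K).
Proof.
move=> e0 cT oOm; apply: measurableD; first exact: open_measurable_rV.
have mcopy k : measurable (scaled_copy eps T k).
  pose g (x : 'rV[R]_d) : 'rV[R]_d := eps^-1 *: x - lattice R k.
  have mg : measurable_fun setT g.
    apply: measurable_fun_coord => i; apply: measurable_funTS.
    under eq_fun do rewrite !mxE.
    apply: measurable_funB => //; apply: measurable_funM => //.
    exact: measurable_coord.
  rewrite (_ : scaled_copy eps T k = g @^-1` T).
    by rewrite -[X in measurable X]setTI; apply: mg => //; exact: closed_measurable_rV.
  apply/seteqP; split => [_ [y Ty <-]|x Tx].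
    by rewrite /g /= scalerA mulVf ?gt_eqF// scale1r addrC addKr.
  by exists (g x) => //; rewrite /g addrC subrK scalerA mulfV ?gt_eqF// scale1r.
rewrite bigcup_mkcond; apply: countable_bigcupT_measurable => [|k].
  exact: countableP.
by case: ifP => _; [exact: mcopy|exact: measurable0].
Qed.

Theorem theorem3 (R : realType) (d : nat) (hd : d = 2%N \/ d = 3%N)
  (* geometry *)
  (Om T : set 'rV[R]_d) (K : R -> set 'rV[int]_d)
  (hOm : polyhedral_domain Om) (hT : cell_hole T)
  (hgeo : forall e : R, 0 < e < 1 -> perforated_geometry e T Om (K e))
  (* Poincare constant, independent of eps *)
  (Cp : R) (hCp : 0 < Cp)
  (hpoincare : forall e : R, 0 < e < 1 ->
     poincare (perforated e T Om (K e)) (boundary Om) Cp)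
  (* (A1)-(A3) *)
  (A : 'rV[R]_d -> 'M[R]_d) (glow gup : R) (hA : coefficient A glow gup)
  (Rf : R -> R) (x0 delta0 delta1 : R) (hR : degenerate Rf x0 delta0 delta1)
  (f : 'rV[R]_d -> R) (hf : L2 Om f)
  (alpha : R) (halpha : 0 <= alpha) (eps : R) (heps : 0 < eps < 1)
  (* regularization parameters and regularizations, indexed by k >= 1 *)
  (sigma Creg : R) (hsigma : 0 < sigma) (hCreg : 0 < Creg)
  (gam : nat -> R) (Rg : nat -> R -> R)
  (hgam_gt0 : forall k : nat, (1 <= k)%N -> 0 < gam k)
  (hgam_noninc : forall k : nat, (1 <= k)%N -> gam k.+1 <= gam k)
  (hRg : forall k : nat, (1 <= k)%N ->
     regularization Rf delta0 delta1 Creg sigma (gam k) (Rg k))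
  (eta M : R) (heta : 0 < eta) (hM : M = eta + eps `^ alpha * delta1)
  (omega C : R) (homega : 0 < omega < 1) (hC : 0 < C)
  (hratio : forall k : nat, (2 <= k)%N ->
     gam k.-1 `^ sigma / gam k <= C * omega ^+ k)
  (homegabar : omega + Num.sqrt (M / (glow * Cp^-1 + M)) < 1) :
  let Om_eps := perforated eps T Om (K eps) in
  let Gext := boundary Om in
  (forall (u : nat -> 'rV[R]_d -> R) (g : nat -> 'rV[R]_d -> 'rV[R]_d),
     iteration Om_eps Gext A eps alpha Rg M f u g -> H1_cauchy Om_eps u g) /\
  (exists (u : 'rV[R]_d -> R) (g : 'rV[R]_d -> 'rV[R]_d),
     weak_solution Om_eps Gext A eps alpha Rf f u g /\
     forall (v : 'rV[R]_d -> R) (h : 'rV[R]_d -> 'rV[R]_d),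
       weak_solution Om_eps Gext A eps alpha Rf f v h ->
       {ae lebesgue_rV R d, forall x, Om_eps x -> v x = u x}).
Proof.
move=> D G.
have [_ oOm _ _ _] := hOm; have [_ cT _ _] := hT.
have e0 : 0 < eps by case/andP: heps.
have [_ bD _ _ _] := hgeo _ heps; rewrite -/D in bD.
have mD : measurable D by exact: perforated_measurable.
have sf : sqint (lebesgue_rV R d) D f.
  have mOm := open_measurable_rV oOm; have [mf intf] := hf.
  have DOm : D `<=` Om by move=> x [].
  by split; [exact: measurable_funS mf|exact: integrableS intf].
have hP := hpoincare _ heps; rewrite -/D -/G in hP.
have [d1_gt0 _ _ _] := hR; have d1_ge0 := ltW d1_gt0.
set kappa := eps `^ alpha in hM.
have k0 : 0 <= kappa by exact: powR_ge0.
have M0 : 0 < M by rewrite hM ltr_wpDr// mulr_ge0.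
have kM : kappa * delta1 <= M by rewrite hM lerDr ltW.
have [w0 w1] := andP homega.
have gam1 k : (0 < k)%N -> gam k <= gam 1%N.
  by case: k => // k _; elim: k => [//|k ih]; apply: le_trans ih; exact: hgam_noninc.
(* The ratio condition at [k.+1], multiplied by [gam k.+1 <= gam 1], with one power of [omega] given
   away. *)
have gams k : (0 < k)%N -> gam k `^ sigma <= C * gam 1%N * omega ^+ k.
  move=> kp; have gp : 0 < gam k.+1 by exact: hgam_gt0.
  have := hratio k.+1 kp; rewrite ler_pdivrMr//= => /le_trans; apply.
  rewrite mulrAC -mulrA -[leRHS]mulrA ler_pM2l//.
  apply: ler_pM; rewrite ?exprn_ge0 ?(ltW gp) ?(ltW w0) ?gam1//.
  by rewrite exprS ler_piMl ?exprn_ge0 ?(ltW w0)// ltW.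
have slopeRg k : (0 < k)%N -> slope_within delta1 (Rg k).
  move=> kp; apply: derive_slope_within => x; have [dx gd /andP[h1 h2] _] := hRg k kp x.
  by split => //; rewrite h2 andbT (le_trans (ltW gd)).
have slopeRf : slope_within delta1 Rf.
  apply: slope_within_lim => e ep.
  have w01 : 0 <= omega < 1 by rewrite w1 ltW.
  have [N HN] := expr_small (Creg * (C * gam 1%N)) w01 ep.
  exists (Rg N.+1); first exact: slopeRg.
  move=> x; have [_ _ _ h] := hRg N.+1 isT x; apply: (le_trans h).
  apply: le_trans (ltW (HN N.+1 (leqnSn N))).
  by rewrite -mulrA ler_pM2l//; exact: gams.
(* Increments of [kappa * r] lie between 0 and [kappa * delta1 * (t - s) <= M * (t - s)], so
   subtracting them from those of [M * s] leaves slopes in [[0, M]]. *)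
have lipS r : slope_within delta1 r -> forall s t,
    `|(M * s - kappa * r s) - (M * t - kappa * r t)| <= M * `|s - t|.
  move=> hr s t; apply: (@slope_within_lipschitz _ M (fun s => M * s - kappa * r s)).
  move=> {}s {}t st; have /andP[r0 r1] := hr s t st.
  have -> : M * t - kappa * r t - (M * s - kappa * r s) =
    M * (t - s) - kappa * (r t - r s) by ring.
  rewrite subr_ge0 gerBl mulr_ge0// andbT.
  apply: (@le_trans _ _ (kappa * (delta1 * (t - s)))); first exact: ler_wpM2l.
  by rewrite mulrA ler_wpM2r// subr_ge0.
have lipr r : slope_within delta1 r -> forall s t, `|r s - r t| <= delta1 * `|s - t|.
  by move=> hr s t; exact: slope_within_lipschitz.
have sq1 : Num.sqrt (M / (glow * Cp^-1 + M)) < 1.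
  by apply: le_lt_trans homegabar; rewrite lerDr ltW.
have pS := pairL2_subspace mD.
pose S k s := M * s - kappa * Rg k s.
split=> [u g [u0 hit]|].
  pose U k : ('rV[R]_d -> R^o) * ('rV[R]_d -> 'rV[R]_d) := (u k, g k).
  have HU k : (0 < k)%N -> pairH1z D G (U k) by move=> /hit[].
  have LU k : (0 < k)%N -> pairL2 D (U k) by move=> /HU/pairH1z_pairL2.
  have sU k : sqint (lebesgue_rV R d) D (U k).1.
    by case: k => [|k]; [rewrite /U u0; exact: const_sqint|case: (LU k.+1 isT)].
  have cU : semi_cauchy (ipH D) (fun k => U k.+1).
    apply: (iterates_cauchy mD bD M0 hA hCp hP sf (S := S) (eps := eps) (u := U)
      (omega := omega) (c := kappa * (Creg * (C * gam 1%N) + Creg * (C * gam 1%N)))) => //.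
    - by rewrite mulr_ge0// addr_ge0// !mulr_ge0// ltW// hgam_gt0.
    - by move=> k s t kp; apply: lipS; exact: slopeRg.
    - move=> k s kp; have [_ _ _ h1] := hRg k kp s; have [_ _ _ h2] := hRg k.+1 isT s.
      (* Consecutive regularizations are compared through [Rf], hence the two equal summands in the
         error constant; the one for [k.+1] is reduced to [k] by monotonicity of [gam]. *)
      rewrite /S (_ : _ - _ = kappa * ((Rf s - Rg k.+1 s) - (Rf s - Rg k s))); last by ring.
      rewrite normrM (ger0_norm k0) -[leRHS]mulrA ler_wpM2l//.
      apply: (le_trans (ler_normB _ _)); rewrite mulrDl lerD//.
        apply: (le_trans h2); rewrite -mulrA ler_pM2l//.
        apply: le_trans (gams k kp); apply: ge0_ler_powR; rewrite ?nnegrE ?(ltW hsigma)//.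
        - by rewrite ltW// hgam_gt0.
        - by rewrite ltW// hgam_gt0.
        - exact: hgam_noninc.
      by apply: (le_trans h1); rewrite -mulrA ler_pM2l//; exact: gams.
    - move=> k; have lk := lipr _ (slopeRg k.+1 isT).
      apply/(stepP G A eps M mD bD sf kappa (U k.+1) d1_ge0 lk (sU k)).
      have [hH hv] := hit k.+1 isT; split => // v Hv; exact: (hv v.1 v.2 Hv).
  (* The threshold [N.+1] excludes the index 0 and undoes the shift. *)
  move=> e ep; have [N HN] := cU e ep; exists N.+1 => -[//|p] [//|q] Np Nq.
  have := HN p q Np Nq; rewrite -(H1normE mD)//.
  by apply: subspaceB => //; exact: LU.
have [u hu] := fixed_point_exists eps mD bD M0 hA hCp hP sf (lipS _ slopeRf) sq1.
have su : sqint (lebesgue_rV R d) D u.1 by case: hu => /pairH1z_pairL2[].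
have weakP w : sqint (lebesgue_rV R d) D w.1 ->
    step D G A eps M f (fun s => M * s - kappa * Rf s) w w <->
    weak_solution D G A eps alpha Rf f w.1 w.2.
  move=> sw; rewrite (stepP G A eps M mD bD sf kappa w d1_ge0 (lipr _ slopeRf) sw).
  split=> -[Hw hw]; split => //.
    move=> phi h Hv; have := hw (phi, h) Hv => /=; rewrite -/kappa /ip2 /=; lra.
  move=> v Hv; have := hw v.1 v.2 Hv; rewrite -/kappa /ip2 /=; lra.
exists u.1, u.2; split; first exact: (weakP u su).1.
move=> v h hv.
have sv : sqint (lebesgue_rV R d) D v by case: hv => -[[]].
apply: (step_unique mD bD M0 hA hCp hP sf (v := (v, h)) (lipS _ slopeRf) hu).
exact: (weakP (v, h) sv).2.
Qed.
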